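(* Let $n\geq1$, $\lambda>0$, and let $K\subset\mathbb{R}^{n+1}$ be a $\lambda$-concave convex body. Let $S_\lambda\subset\mathbb{R}^{n+1}$ be a $\lambda$-sausage body with $\operatorname{diam}(K)=\operatorname{diam}(S_\lambda)$. Then $W_i(K)\geq W_i(S_\lambda)$ for every $i\in\{0,1,\dots,n\}$. Moreover, equality holds if and only if $K$ is a $\lambda$-sausage body.
   Context: A convex body is a compact convex set with non-empty interior; balls are closed. For $\lambda>0$, a convex body $K\subset\mathbb{R}^{n+1}$ is $\lambda$-concave if for every $p\in\partial K$ there is a ball of radius $1/\lambda$ whose boundary passes through $p$ and which, intersected with some open neighborhood $U(p)$ of $p$, is contained in $K\cap U(p)$. A $\lambda$-sausage body is the convex hull of two (possibly coinciding) balls of radius $1/\lambda$. $\operatorname{diam}(K)=\max_{p,q\in K}|pq|$. The quermassintegrals $W_i(K)$ are defined by the Steiner formula $\mathrm{Vol}_{n+1}(K+tB)=\sum_{i=0}^{n+1}\binom{n+1}{i}W_i(K)t^i$, $t\geq0$, with $B$ the unit ball and $+$ Minkowski addition. *)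

(* Defs.v *)
From HB Require Import structures.
From mathcomp Require Import all_boot all_order all_algebra.
From mathcomp Require Import all_classical all_reals all_analysis.
Set Implicit Arguments. Unset Strict Implicit. Unset Printing Implicit Defensive.
Import Order.TTheory GRing.Theory Num.Theory.
Import numFieldNormedType.Exports.
Local Open Scope classical_set_scope.
Local Open Scope ring_scope.

Section Convex_geometry.
Variable R : realType.

Definition enorm (m : nat) (x : 'rV[R]_m) : R := Num.sqrt (\sum_i x 0 i ^+ 2).
Definition edist (m : nat) (p q : 'rV[R]_m) : R := enorm (p - q).

Definition cball (m : nat) (c : 'rV[R]_m) (r : R) : set 'rV[R]_m :=
  [set x | edist x c <= r].

Definition convex_set (m : nat) (A : set 'rV[R]_m) : Prop :=
  forall x y, A x -> A y -> forall t : R, 0 <= t <= 1 -> A (t *: x + (1 - t) *: y).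

Definition conv_hull (m : nat) (A : set 'rV[R]_m) : set 'rV[R]_m :=
  [set x | forall C, convex_set C -> A `<=` C -> C x].

Definition convex_body (m : nat) (K : set 'rV[R]_m) : Prop :=
  [/\ compact K, convex_set K & (K°) !=set0].

Definition boundary (m : nat) (K : set 'rV[R]_m) : set 'rV[R]_m :=
  closure K `\` K°.

Definition lambda_concave (m : nat) (lam : R) (K : set 'rV[R]_m) : Prop :=
  convex_body K /\
  forall p, boundary K p ->
    exists c, edist p c = lam^-1 /\
      exists U : set 'rV[R]_m, [/\ open U, U p & cball c lam^-1 `&` U `<=` K `&` U].

Definition sausage (m : nat) (lam : R) (S : set 'rV[R]_m) : Prop :=
  exists a b, S = conv_hull (cball a lam^-1 `|` cball b lam^-1).

Definition diam (m : nat) (K : set 'rV[R]_m) : R :=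
  sup [set d | exists p q, [/\ K p, K q & d = edist p q]].

Definition minkowski (m : nat) (A B : set 'rV[R]_m) : set 'rV[R]_m :=
  [set z | exists a b, [/\ A a, B b & z = a + b]].

Definition scale_set (m : nat) (t : R) (A : set 'rV[R]_m) : set 'rV[R]_m :=
  [set z | exists a, A a /\ z = t *: a].

(* Lebesgue volume on R^m, as iterated one-dimensional Lebesgue integrals
   (Tonelli): vol_0 is the counting measure on the one-point space,
   vol_(m+1) A = \int_R vol_m (section of A at first coordinate x). *)
Definition rsection (m : nat) (A : set 'rV[R]_m.+1) (x : R) : set 'rV[R]_m :=
  [set y | A (row_mx (const_mx x : 'rV[R]_1) y)].

Fixpoint vol (m : nat) : set 'rV[R]_m -> \bar R :=
  match m with
  | 0%N => fun A => if `[< A !=set0 >] then 1%E else 0%E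
  | m'.+1 => fun A =>
      (\int[@lebesgue_measure R]_(x in [set: R]) vol (rsection A x))%E
  end.

Definition steiner_poly (m : nat) (K : set 'rV[R]_m) : {poly R} :=
  xget 0 [set p : {poly R} | (size p <= m.+1)%N /\
     forall t : R, 0 <= t ->
       vol (minkowski K (scale_set t (cball 0 1))) = (p.[t])%:E].

(* quermassintegral W_i: Vol(K+tB) = sum_i binom(m,i) W_i(K) t^i *)
Definition quermass (m : nat) (K : set 'rV[R]_m) (i : nat) : R :=
  (steiner_poly K)`_i / ('C(m, i))%:R.

End Convex_geometry.

(* Main.v *)
(* Write r = 1/lam and let K' be the set of centres of balls of radius r contained in K.  Local
   inner balls force the support function of K minus r|.| to have local linear minorants, hence
   to be convex, so K = K' + rB.  Balls of radius r inscribed at the endpoints of a diameter of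
   K have centres a, b in K' with |ab| = diam K - 2r, so K contains a congruent copy of the
   sausage.

   The Steiner polynomial of a convex compact L exists because B is a limit of zonotopes Z (the
   norm is approximated by averages of |<u, .>| over finitely many reflections) and
   vol (L + t Z) is a polynomial in t whose coefficients are nonnegative and monotone in L.

   If q_L denotes that polynomial, then vol (K + tB) = q_K' (r + t), so by Taylor expansion at r
   all W_i with i <= n are strictly monotone as soon as the coefficient of degree n of q is.
   If x is in L but not in I, the shells of a thin cone with apex x show that
   q_L (t) - q_I (t) grows at least like t^n, while the coefficients of degree n + 1 agree. *)
Require Import Defs.
From HB Require Import structures.
From mathcomp Require Import all_boot all_order all_algebra.
From mathcomp Require Import ring lra.
From mathcomp Require Import all_classical all_reals all_analysis measurable_realfun.
Set Implicit Arguments. Unset Strict Implicit. Unset Printing Implicit Defensive.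
Import Order.TTheory GRing.Theory Num.Theory.
Import numFieldNormedType.Exports.
Local Open Scope classical_set_scope.
Local Open Scope ring_scope.
Import Defs.

(** * Volume as a Borel measure *)

Section Volume.
Variable R : realType.
Notation mR := (measurableTypeR R).

(** Strict inclusion of inner bodies is not visible in their volumes: a segment has volume zero in
    dimension at least two, and [K'] may be flat as well. They are told apart by their parallel
    bodies at large distance, hence the growth argument. The coefficient of degree [n + 1] is the
    same for all nonempty bodies, so degree [n] is the highest one where a difference can show; this
    is where [i <= n] comes from.

    Zonotopes enter because a segment acts on volume in an elementary way: it lengthens every
    nonempty chord parallel to it by a constant. Adding segments one at a time yields polynomiality,
    nonnegativity and monotonicity together, without mixed volumes. The passage to the ball keeps
    only weak inequalities.

    In dimension one every short interval satisfies the local ball condition, so the passage from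
    local to inscribed balls has to use [n >= 1].

    Invariance of an iterated integral under isometries is not evident. It is needed because the
    segment found in [K'] and the one defining the sausage have equal length but in general
    different directions. *)

(* The iterated integral [vol] is defined on all sets; it is shown below to be a sigma-finite
   measure on this Borel structure. *)
Definition borelV (m : nat) := g_sigma_algebraType (@open 'rV[R]_m).
Notation V := borelV.

Lemma borel_open m (U : set 'rV[R]_m) : open U -> measurable (U : set (V m)).
Proof. by move=> oU; exact: sub_sigma_algebra. Qed.

Lemma borel_closed m (F : set 'rV[R]_m) : closed F -> measurable (F : set (V m)).
Proof.
move=> cF; rewrite -(setCK F); apply: measurableC; apply: borel_open.
exact: closed_openC.
Qed.

Lemma rV_hausdorff m : hausdorff_space 'rV[R]_m.
Proof. exact: norm_hausdorff. Qed.

Lemma borel_compact m (F : set 'rV[R]_m) : compact F -> measurable (F : set (V m)).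
Proof. by move=> cF; apply: borel_closed; apply: compact_closed => //; exact: rV_hausdorff. Qed.

(** Second countability in the form used by [measurable_fun_rV]: since [ball] belongs to the sup
    norm, the preimage of an open set becomes a countable union of finite intersections of
    conditions on single coordinates. *)
Lemma open_rat_balls m (U : set 'rV[R]_m) : open U ->
  U = \bigcup_(qk in [set qk : 'rV[rat]_m * nat |
        ball (map_mx ratr qk.1 : 'rV[R]_m) qk.2.+1%:R^-1 `<=` U])
      ball (map_mx ratr qk.1 : 'rV[R]_m) qk.2.+1%:R^-1.
Proof.
move=> oU; apply/seteqP; split => [x Ux|x [qk /= sU]]; last exact: sU.
have /nbhs_ballP [e /= e0 eU] : nbhs x U by exact: open_nbhs_nbhs.
have [k ke] : exists k : nat, (k.+1%:R^-1 : R) < e / 2.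
  have := near_infty_natSinv_lt (PosNum (divr_gt0 e0 (ltr0Sn R 1))).
  by move=> [N _ /(_ N (leqnn N)) /=]; exists N.
have k0 : 0 < (k.+1%:R^-1 : R) by rewrite invr_gt0.
have rq (i : 'I_m) : exists q : rat, ball (x 0 i) k.+1%:R^-1 (ratr q : R).
  have nx : ball (x 0 i) (k.+1%:R^-1 : R) !=set0 by exists (x 0 i); exact: ballxx.
  have [y [qy [q _ yq]]] := @dense_rat R _ nx (ball_open _ _).
  by exists q; rewrite yq.
have [q Hq] := choice rq.
have qx : ball (map_mx ratr (\row_i q i) : 'rV[R]_m) k.+1%:R^-1 x.
  by split => // i j; rewrite (ord1 i) !mxE; apply: ball_sym; exact: Hq.
exists (\row_i q i, k) => //= y yq; apply: eU.
apply: (@le_ball _ _ _ (k.+1%:R^-1 + k.+1%:R^-1)); last first.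
  by apply: ball_triangle yq; apply: ball_sym.
by rewrite (splitr e) lerD // ltW.
Qed.

Lemma measurable_fun_rV d (T : measurableType d) m (f : T -> V m) :
  (forall i, measurable_fun setT (fun w => (f w : 'rV[R]_m) 0 i : mR)) ->
  measurable_fun setT f.
Proof.
move=> mf; apply: (@measurability _ _ _ (V m) _ _ (@open 'rV[R]_m)) => //.
move=> _ [U oU <-]; rewrite setTI [U]open_rat_balls // preimage_bigcup.
rewrite bigcup_mkcond; apply: countable_bigcupT_measurable => // qk.
case: ifP => // _.
have -> : f @^-1` ball (map_mx ratr qk.1 : 'rV[R]_m) qk.2.+1%:R^-1 =
   \bigcap_(i : 'I_m) ((fun w => (f w : 'rV[R]_m) 0 i) @^-1`
       ball (ratr (qk.1 0 i) : R) qk.2.+1%:R^-1).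
  apply/seteqP; split => [w [_ /= H] i _ /=|w /= H]; first by have := H 0 i; rewrite mxE.
  by split; [rewrite invr_gt0|move=> i j; rewrite (ord1 i) mxE; exact: H].
apply: fin_bigcap_measurable => // i _.
by rewrite -[X in measurable X]setTI; apply: mf => //; apply: open_measurable; exact: ball_open.
Qed.

Lemma measurable_coord m (i : 'I_m) :
  measurable_fun setT (fun v : V m => (v : 'rV[R]_m) 0 i : mR).
Proof.
apply: (measurability _ (RGenOpens.measurableE R)).
move=> _ [_ [a [b ->]] <-]; rewrite setTI.
apply: borel_open; apply: open_comp; last exact: itv_open.
by move=> x _; exact: coord_continuous.
Qed.

(** Stated as an existence so that it can be applied inside the induction on the dimension, where
    [vol] becomes a measure one dimension at a time. *)
Lemma sigma_finite_measure_pack d (T : measurableType d) (mu : set T -> \bar R) :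
  mu set0 = 0%E -> (forall A, (0 <= mu A)%E) -> semi_sigma_additive mu ->
  sigma_finite setT mu ->
  exists nu : {sigma_finite_measure set T -> \bar R}, nu = mu :> (set T -> \bar R).
Proof.
move=> mu0 mu_ge0 mu_add mu_fin.
pose H1 := isMeasure.Build _ _ _ mu mu0 mu_ge0 mu_add.
pose nu1 : Measure.type T R := HB.pack mu H1.
have nu1_fin : sigma_finite setT nu1 by [].
pose H2 := Measure_isSigmaFinite.Build _ _ _ nu1 nu1_fin.
pose nu : SigmaFiniteMeasure.type T R :=
  HB.pack_for (SigmaFiniteMeasure.type T R) (Measure.sort nu1) H2.
by exists nu.
Qed.

Definition consV m (p : mR * V m) : V m.+1 :=
  (row_mx (const_mx p.1 : 'rV[R]_1) (p.2 : 'rV[R]_m) : 'rV[R]_(1 + m)).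

Lemma consV0 m (p : mR * V m) : (consV p : 'rV[R]_m.+1) 0 0 = p.1.
Proof.
have <- : lshift m (0 : 'I_1) = 0 :> 'I_(1 + m) by exact: val_inj.
by apply: etrans (row_mxEl _ _ _ _) _; rewrite mxE.
Qed.

Lemma consVS m (p : mR * V m) i :
  (consV p : 'rV[R]_m.+1) 0 (lift ord0 i) = (p.2 : 'rV[R]_m) 0 i.
Proof.
have <- : rshift 1 i = lift ord0 i :> 'I_(1 + m) by exact: val_inj.
by apply: etrans (row_mxEr _ _ _ _) _.
Qed.

Lemma measurable_consV m : measurable_fun setT (@consV m).
Proof.
apply: measurable_fun_rV => i; have [->|[j ->]] : i = 0 \/ exists j, i = lift ord0 j.
- by case: (unliftP ord0 i) => [j ->|->]; [right; exists j|left].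
- by under eq_fun do rewrite consV0; exact: measurable_fst.
under eq_fun do rewrite consVS.
by apply: (measurableT_comp (measurable_coord j)); exact: measurable_snd.
Qed.

Lemma xsection_consV m (A : set (V m.+1)) x :
  xsection (@consV m @^-1` A) x = rsection (A : set 'rV[R]_m.+1) x.
Proof. by apply/seteqP; split => y; rewrite xsectionE. Qed.

(** The product measure is by definition the integral of the measures of the sections, so the
    recursion of [vol] is a product measure as soon as the lower dimensional [vol] is some measure
    [mu]. *)
Lemma vol_product m (mu : set (V m) -> \bar R) (A : set 'rV[R]_m.+1) :
  mu = (@vol R m : set (V m) -> _) ->
  vol A = (@lebesgue_measure R \x mu)%E (@consV m @^-1` A).
Proof.
move=> muE; rewrite /vol -/vol /product_measure1; apply: eq_integral => x _ /=.
by rewrite xsection_consV muE.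
Qed.

Lemma vol_ge0 m (A : set 'rV[R]_m) : (0 <= vol A)%E.
Proof.
elim: m A => [A|m IH A] /=; first by case: ifP.
by apply: integral_ge0.
Qed.

Lemma vol_set0 m : vol (set0 : set 'rV[R]_m) = 0%E.
Proof.
elim: m => [|m IH] /=.
  by case: asboolP => // -[x].
by rewrite integral0_eq.
Qed.

Definition cube m (a : R) : set 'rV[R]_m := [set x | forall i, `|x 0 i| <= a].
Arguments cube : clear implicits.

Lemma closed_cube m (a : R) : closed (cube m a).
Proof.
rewrite (_ : cube m a = \bigcap_(i : 'I_m) [set x : 'rV[R]_m | `|x 0 i| <= a]).
  apply: closed_bigI => i _.
  apply: (@closed_comp _ _ (fun x : 'rV[R]_m => `|x 0 i|) [set y | y <= a]); last exact: closed_le.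
  move=> x _; apply: continuous_comp; [exact: coord_continuous|exact: norm_continuous].
by apply/seteqP; split => [x H i _|x H i] /=; apply: H.
Qed.

Lemma vol_cube m (a : R) : 0 <= a -> vol (cube m a) = ((2 * a) ^+ m)%:E.
Proof.
move=> a0; elim: m => [|m IH].
  by rewrite /= expr0 asboolT//; exists 0 => -[].
rewrite /vol -/vol.
rewrite (eq_integral (fun x => (((2 * a) ^+ m)%:E * (\1_(`[(- a), a]%classic : set mR) x)%:E))%E);
  last first.
  move=> x _; rewrite indicE mem_setE in_itv /= -ler_norml; case: (boolP (`|x| <= a)) => xa.
    rewrite mule1 -IH; congr vol; apply/seteqP; split => y /= H.
      by move=> i; have := H (lift ord0 i); rewrite (consVS (x, y)).
    move=> i; case: (unliftP ord0 i) => [j ->|->].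
      by have := consVS (x, y) j; rewrite /consV /= => ->.
    by have := consV0 (x, y); rewrite /consV /= => ->.
  rewrite mule0; apply: (etrans _ (@vol_set0 m)); congr (@vol R m _); apply/seteqP; split =>
    y //= H.
  have := H ord0; have := consV0 (x, y); rewrite /consV /= => ->.
  by rewrite (negbTE xa).
rewrite ge0_integralZl //=; last 2 first.
- by apply/measurable_EFinP; apply: measurable_indic; exact: measurable_itv.
- by rewrite lee_fin exprn_ge0// mulr_ge0.
rewrite integral_indic // setIT.
have := lebesgue_measure_itv `[- a, a] => /= ->; rewrite lte_fin.
case: ltP => [_|a_le]; first by rewrite -EFinB -EFinM exprSr; congr (_ * _)%:E; lra.
(* The length formula returns [0] when [- a < a] fails; with [0 <= a] this leaves only the
   degenerate interval. *)
have -> : a = 0 by lra.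
by rewrite mulr0 exprS mul0r mule0.
Qed.

Lemma cube_cover m : \bigcup_(k : nat) cube m k%:R = setT.
Proof.
apply/seteqP; split => // x _; exists (Num.truncn (\sum_i `|x 0 i|)).+1 => // i.
rewrite (le_trans _ (ltW (truncnS_gt _)))//.
by rewrite (bigD1 i) //= lerDl sumr_ge0.
Qed.

Lemma vol_sigma_finite m : sigma_finite setT (@vol R m : set (V m) -> _).
Proof.
exists (fun k => cube m k%:R); first by rewrite cube_cover.
by move=> k; split; [apply: borel_closed; exact: closed_cube|rewrite vol_cube ?ltry].
Qed.

(** By induction: the Dirac mass in dimension [0], then the product of Lebesgue measure with the
    previous [vol], transported along [consV]. *)
Lemma vol_measure m : exists mu : {sigma_finite_measure set (V m) -> \bar R},
  mu = (@vol R m : set (V m) -> _) :> (set (V m) -> \bar R).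
Proof.
apply: sigma_finite_measure_pack; [exact: vol_set0|exact: vol_ge0| |].
- elim: m => [|m IH].
    have -> : (@vol R 0 : set (V 0) -> _) = dirac (0 : V 0).
      apply/funext => A; rewrite diracE /=; case: asboolP => [[x Ax]|nA].
        by rewrite mem_set // -[X in A X](_ : x = _)// ; apply/rowP => -[].
      by rewrite memNset // => A0; apply: nA; exists 0.
    exact: measure_semi_sigma_additive.
  have [mu muE] : exists nu : {sigma_finite_measure set (V m) -> \bar R},
      nu = (@vol R m : set (V m) -> _) :> (set (V m) -> \bar R).
    apply: sigma_finite_measure_pack; [exact: vol_set0|exact: vol_ge0|exact: IH|exact:
      vol_sigma_finite].
  move=> F mF tF mUF.
  have mc (A : set (V m.+1)) : measurable A -> measurable (@consV m @^-1` A).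
    by move=> mA; rewrite -[X in measurable X]setTI; apply: measurable_consV.
  rewrite (vol_product _ muE) preimage_bigcup.
  under eq_fun do under eq_bigr do rewrite (vol_product _ muE).
  apply: measure_semi_sigma_additive.
  + by move=> n; exact: mc.
  + apply/trivIsetP => /= i j _ _ ij; rewrite -preimage_setI.
    by move/trivIsetP : tF => /(_ _ _ _ _ ij) ->//; rewrite preimage_set0.
  + by rewrite -preimage_bigcup; exact: mc.
exact: vol_sigma_finite.
Qed.

(** Uniqueness of Lebesgue measure: the pushforward under the translation gives half-open intervals
    the same length. *)
Lemma lebesgue_measure_shift (a : R) (A : set mR) : measurable A ->
  lebesgue_measure [set x : mR | A (x + a)] = lebesgue_measure A.
Proof.
move=> mA; have mf : measurable_fun setT (fun x : mR => x + a : mR).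
  exact: measurable_funD.
pose nu : {measure set mR -> \bar R} :=
  measure_function_pushforward__canonical__measure_function_Measure (@lebesgue_measure R) mf.
apply/esym; apply: (@lebesgue_measure_unique R nu) => // X [[x y] /= xy <-].
rewrite /nu /= /pushforward.
have -> : (fun z : mR => z + a) @^-1` `]x, y]%classic = `]x - a, y - a]%classic.
  by apply/seteqP; split => z; rewrite /= !in_itv /= ltrBlDr lerBrDr.
have /= -> := lebesgue_measure_itv `]x, y]; have /= -> := lebesgue_measure_itv `]x - a, y - a].
by rewrite !lte_fin ltrD2r; case: ifP => // _; rewrite -!EFinB; congr EFin; lra.
Qed.

Lemma integral_shift (a : R) (f : mR -> \bar R) : measurable_fun setT f ->
  (forall x, 0 <= f x)%E ->
  (\int[lebesgue_measure]_x f (x + a)%R = \int[lebesgue_measure]_x f x)%E.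
Proof.
move=> mf f0; have ms : measurable_fun setT (fun x : mR => x + a : mR).
  exact: measurable_funD.
have := ge0_integral_pushforward ms lebesgue_measure measurableT mf (fun x _ => f0 x).
rewrite preimage_setT => <-; apply: eq_measure_integral => A mA _.
exact: lebesgue_measure_shift.
Qed.
End Volume.

Arguments cube {R} m a.

(** * Translations, shears, and the volume of a body thickened by a segment *)

Section VolumeTheory.
Variable R : realType.
Notation mR := (measurableTypeR R).
Notation V := (borelV R).

Lemma measurable_consV_comp m (A : set (V m.+1)) : measurable A ->
  measurable (@consV R m @^-1` A).
Proof. by move=> mA; rewrite -[X in measurable X]setTI; apply: measurable_consV. Qed.

Lemma measurable_rsection m (A : set (V m.+1)) (x : R) : measurable A ->
  measurable (rsection (A : set 'rV[R]_m.+1) x : set (V m)).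
Proof.
move=> mA; rewrite -xsection_consV; apply: measurable_xsection.
exact: measurable_consV_comp.
Qed.

Lemma measurable_vol_rsection m (A : set (V m.+1)) : measurable A ->
  measurable_fun setT (fun x : mR => vol (rsection (A : set 'rV[R]_m.+1) x)).
Proof.
move=> mA; have [mu muE] := vol_measure R m.
have := measurable_fun_xsection mu (measurable_consV_comp mA).
by apply: eq_measurable_fun => x _ /=; rewrite xsection_consV muE.
Qed.

Lemma consV_shift m (x : R) (y a' : 'rV[R]_m) (a0 : R) :
  consV (x, y : V m) + consV (a0, a' : V m) = consV (x + a0, y + a' : V m) :> 'rV[R]_m.+1.
Proof.
apply/rowP => i; rewrite mxE; case: (unliftP ord0 i) => [j ->|->].
  by rewrite !consVS /= mxE.
by rewrite !consV0.
Qed.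

Lemma consV_eta m (a : 'rV[R]_m.+1) :
  a = consV (a 0 0, (\row_j a 0 (lift ord0 j)) : V m).
Proof.
apply/rowP => i; case: (unliftP ord0 i) => [j ->|->].
  by rewrite !consVS mxE.
by rewrite !consV0.
Qed.

Lemma vol_shift m (A : set (V m)) (a : 'rV[R]_m) : measurable A ->
  vol [set x : 'rV[R]_m | A (x + a)] = vol (A : set 'rV[R]_m).
Proof.
elim: m A a => [|m IH] A a mA /=.
  have a0 (x : 'rV[R]_0) : x + a = x by apply/rowP => -[].
  by congr (if `[< _ >] then _ else _); congr nonempty; apply/seteqP; split => x; rewrite /= a0.
have H (x : mR) : vol (rsection [set x : 'rV[R]_m.+1 | A (x + a)] x) =
    vol (rsection (A : set 'rV[R]_m.+1) (x + a 0 0)).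
  rewrite -(IH _ (\row_j a 0 (lift ord0 j)) (measurable_rsection (x + a 0 0) mA)).
  congr vol; apply/funext => y; apply/propext; rewrite /rsection /=.
  have /esym := consV_shift x y (\row_j a 0 (lift ord0 j)) (a 0 0).
  by rewrite -consV_eta /consV /= => ->.
rewrite (eq_integral _ _ (fun x _ => H x)).
rewrite (@integral_shift R (a 0 0) (fun x => vol (rsection (A : set 'rV[R]_m.+1) x))) //.
  exact: measurable_vol_rsection.
by move=> x; exact: vol_ge0.
Qed.

Lemma le_vol m (A B : set (V m)) : measurable A -> measurable B -> A `<=` B ->
  (vol (A : set 'rV[R]_m) <= vol (B : set 'rV[R]_m))%E.
Proof.
move=> mA mB AB; have [mu muE] := vol_measure R m.
have E (X : set (V m)) : vol (X : set 'rV[R]_m) = mu X by rewrite muE.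
by rewrite !E; apply: le_measure; rewrite ?inE.
Qed.

Lemma vol_lty m (A : set (V m)) (a : R) : measurable A -> A `<=` cube m a ->
  (vol (A : set 'rV[R]_m) < +oo)%E.
Proof.
move=> mA Aa; have Ab : A `<=` cube m `|a|.
  by move=> x /Aa H i; exact: le_trans (H i) (ler_norm a).
apply: (le_lt_trans (le_vol mA _ Ab)).
  by apply: borel_closed; exact: closed_cube.
by rewrite vol_cube// ltry.
Qed.

(** Integration along the lines of direction [(1, w)] comes first. On the section at first
    coordinate [s] the shear is the translation by [s *: w], which preserves [vol]; Tonelli then
    exchanges the two integrals. *)
Lemma vol_fubini_shear m (mu : {sigma_finite_measure set (V m) -> \bar R})
    (A : set (V m.+1)) (w : 'rV[R]_m) :
  mu = (@vol R m : set (V m) -> _) :> (set (V m) -> \bar R) -> measurable A ->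
  let F := fun y : V m => lebesgue_measure
     [set s : mR | A (consV (s, ((y : 'rV[R]_m) + s *: w) : V m))] in
  measurable_fun setT F /\ vol (A : set 'rV[R]_m.+1) = (\int[mu]_y F y)%E.
Proof.
move=> muE mA F.
pose g (p : mR * V m) : V m.+1 := consV (p.1, ((p.2 : 'rV[R]_m) + p.1 *: w) : V m).
have mg : measurable_fun setT g.
  apply: measurable_fun_rV => i; case: (unliftP ord0 i) => [j ->|->].
    under eq_fun do rewrite consVS /= !mxE.
    apply: measurable_funD.
      by apply: (measurableT_comp (measurable_coord j)); exact: measurable_snd.
    by apply: measurable_funM; [exact: measurable_fst|exact: measurable_cst].
  by under eq_fun do rewrite consV0 /=; exact: measurable_fst.
have mgA : measurable (g @^-1` A) by rewrite -[X in measurable X]setTI; exact: mg.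
have FE y : F y = (@lebesgue_measure R \o ysection (g @^-1` A)) y.
  by rewrite /F /=; congr lebesgue_measure; apply/seteqP; split => s; rewrite ysectionE.
split.
  have := measurable_fun_ysection (@lebesgue_measure R) mgA.
  by apply: eq_measurable_fun => y _; rewrite FE.
under eq_integral do rewrite FE.
transitivity ((@lebesgue_measure R \x mu)%E (g @^-1` A)); last first.
  by rewrite (product_measure_unique (m' := (@lebesgue_measure R \x^ mu)%E)) // => *; exact:
    product_measure2E.
rewrite /product_measure1 /=; apply: eq_integral => x _.
rewrite muE /= -(@vol_shift _ (rsection (A : set 'rV[R]_m.+1) x) (x *: w)); last exact:
  measurable_rsection.
by congr vol; apply/seteqP; split => y; rewrite xsectionE.
Qed.

Lemma continuous_rV (T : topologicalType) m (f : T -> 'rV[R]_m) :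
  (forall i, continuous (fun t => f t 0 i)) -> continuous f.
Proof.
move=> cf t; apply/cvg_ballP => e e0.
have : nbhs t [set t' | forall i, ball (f t 0 i) e (f t' 0 i)].
  apply: filter_forall => i; have /cvg_ballP := cf i t.
  exact.
by apply: filterS => t' H; split => // i j; rewrite (ord1 i); exact: H.
Qed.

Lemma coord_le_norm m (x : 'rV[R]_m) i : `|x 0 i| <= `|x|.
Proof. by rewrite (_ : `|x| = mx_norm x) // mx_normrE; apply/bigmax_geP; right; exists (0, i). Qed.

Lemma norm_le_cube m (x : 'rV[R]_m) (a : R) : 0 <= a -> cube m a x -> `|x| <= a.
Proof.
move=> a0 xa; rewrite (_ : `|x| = mx_norm x) // mx_normrE; apply/bigmax_leP; split => //.
by move=> [i j] _ /=; rewrite (ord1 i).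
Qed.

Lemma compact_cube_subset m (K : set 'rV[R]_m) : compact K ->
  exists2 a : R, 0 <= a & K `<=` cube m a.
Proof.
move=> /compact_bounded [M [_ HM]]; exists (`|M| + 1); first by rewrite addr_ge0.
have MM : M < `|M| + 1 by rewrite (le_lt_trans (ler_norm M))// ltrDl.
move=> x Kx i; by apply: le_trans (HM _ MM x Kx); exact: coord_le_norm.
Qed.

Lemma cube_compact m (K : set 'rV[R]_m) (a : R) : closed K -> K `<=` cube m a ->
  compact K.
Proof.
move=> cK Ka; apply: bounded_closed_compact => //.
exists (Num.max a 0); split; first exact: num_real.
move=> M aM x Kx; have M0 : 0 <= M by apply: ltW; move: aM; rewrite gt_max => /andP[].
apply: norm_le_cube => // j.
by apply: le_trans (Ka _ Kx j) _; apply: ltW; move: aM; rewrite gt_max => /andP[].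
Qed.

Lemma minkowski_image m (A B : set 'rV[R]_m) :
  minkowski A B = (fun p => p.1 + p.2) @` (A `*` B).
Proof.
apply/seteqP; split => [z [a [b [Aa Bb ->]]]|z [[a b] [/= Aa Bb] <-]].
  by exists (a, b).
by exists a, b.
Qed.

Lemma minkowski_compact m (A B : set 'rV[R]_m) :
  compact A -> compact B -> compact (minkowski A B).
Proof.
move=> cA cB; rewrite minkowski_image; apply: continuous_compact; last exact: compact_setX.
by apply: continuous_subspaceT => p; exact: add_continuous.
Qed.

Lemma minkowski_convex m (A B : set 'rV[R]_m) :
  convex_set A -> convex_set B -> convex_set (minkowski A B).
Proof.
move=> cA cB _ _ [a [b [Aa Bb ->]]] [a' [b' [Aa' Bb' ->]]] t t01.
exists (t *: a + (1 - t) *: a'), (t *: b + (1 - t) *: b').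
by split; [exact: cA|exact: cB|rewrite !scalerDr addrACA].
Qed.

Lemma minkowskiA m (A B C : set 'rV[R]_m) :
  minkowski A (minkowski B C) = minkowski (minkowski A B) C.
Proof.
apply/seteqP; split => z.
  by move=> [a [_ [Aa [b [c [Bb Cc ->]]] ->]]]; exists (a + b), c; split; rewrite ?addrA//;
    exists a, b.
by move=> [_ [c [[a [b [Aa Bb ->]]] Cc ->]]]; exists a, (b + c); split; rewrite ?addrA//;
  exists b, c.
Qed.

Lemma minkowskiC m (A B : set 'rV[R]_m) : minkowski A B = minkowski B A.
Proof. by apply/seteqP; split => z [a [b [Aa Bb ->]]]; exists b, a; rewrite addrC. Qed.

Lemma minkowskiS m (A A' B B' : set 'rV[R]_m) :
  A `<=` A' -> B `<=` B' -> minkowski A B `<=` minkowski A' B'.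
Proof. by move=> AA BB z [a [b [/AA Aa /BB Bb ->]]]; exists a, b. Qed.

Definition seg m (u : 'rV[R]_m) : set 'rV[R]_m :=
  [set z | exists s : R, `|s| <= 1 /\ z = s *: u].

Lemma seg_compact m (u : 'rV[R]_m) : compact (seg u).
Proof.
have -> : seg u = (fun s : R => s *: u) @` `[-1, 1]%classic.
  apply/seteqP; split => z.
    by move=> [s [s1 ->]]; exists s => //=; rewrite in_itv /= -ler_norml.
  by move=> [s /=]; rewrite in_itv /= -ler_norml => s1 <-; exists s.
apply: continuous_compact; last exact: segment_compact.
apply: continuous_subspaceT; exact: scalel_continuous.
Qed.

Lemma seg_convex m (u : 'rV[R]_m) : convex_set (seg u).
Proof.
move=> _ _ [s [s1 ->]] [s' [s1' ->]] t /andP[t0 t1].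
exists (t * s + (1 - t) * s'); split; last by rewrite [RHS]scalerDl !scalerA.
by move: s1 s1'; rewrite !ler_norml => /andP[? ?] /andP[? ?]; apply/andP; split; nra.
Qed.

Lemma compact_interval (I : set R) : compact I ->
  (forall x y, I x -> I y -> forall t : R, 0 <= t <= 1 -> I (t * x + (1 - t) * y)) ->
  I = set0 \/ exists p q, p <= q /\ I = `[p, q]%classic.
Proof.
move=> cI vI; have [->|/set0P I0] := eqVneq I set0; [by left|right].
have ci : {within I, continuous (fun x : R => x)}.
  by apply: continuous_subspaceT => x; exact: cvg_id.
have [q Iq Hq] := compact_EVT_max I0 cI ci.
have [p Ip Hp] := compact_EVT_min I0 cI ci.
rewrite inE in Iq; rewrite inE in Ip.
have pq : p <= q by apply: Hp; rewrite inE.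
exists p, q; split => //; apply/seteqP; split => x /=.
  by move=> Ix; rewrite in_itv /= Hp ?inE// Hq ?inE.
rewrite in_itv /= => /andP[px xq].
have [e|npq] := eqVneq p q; first by rewrite (_ : x = p)//; lra.
have pq0 : 0 < q - p by rewrite subr_gt0 lt_neqAle npq.
have -> : x = ((x - p) / (q - p)) * q + (1 - (x - p) / (q - p)) * p.
  by field; rewrite gt_eqF.
apply: vI => //; rewrite divr_ge0 ?subr_ge0 ?(ltW pq0) //=.
by rewrite ler_pdivrMr// mul1r lerD2r.
Qed.

Definition thick (I : set R) (c : R) : set R :=
  [set s | exists a b, [/\ I a, `|b| <= c & s = a + b]].

(** A nonempty interval of length [l] thickens to length [l + 2 * x], which is affine in [x], and
    the empty slice stays empty. The identity is written additively to avoid subtraction in the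
    extended reals. *)
Lemma lebesgue_measure_thick_affine (I : set R) (c t : R) : 0 <= t -> 0 <= c ->
  compact I ->
  (forall x y, I x -> I y -> forall t : R, 0 <= t <= 1 -> I (t * x + (1 - t) * y)) ->
  (lebesgue_measure (thick I (t * c) : set mR) + t%:E * lebesgue_measure (I : set mR) =
   lebesgue_measure (I : set mR) + t%:E * lebesgue_measure (thick I c : set mR))%E.
Proof.
move=> t0 c0 cI vI.
have [->|[p [q [pq ->]]]] := compact_interval cI vI.
  have -> x : thick set0 x = set0 by apply/seteqP; split => // s [? [? []]].
  have -> : thick set0 c = set0 by apply/seteqP; split => // s [? [? []]].
  by rewrite !measure0.
have thickE x : 0 <= x -> lebesgue_measure (thick `[p, q]%classic x : set mR) = (q - p + 2 * x)%:E.
  move=> x0; have -> : thick `[p, q]%classic x = `[p - x, q + x]%classic.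
    apply/seteqP; split => s; rewrite /= in_itv /=.
      move=> [a [b []]]; rewrite /= in_itv /= ler_norml => /andP[? ?] /andP[? ?] ->.
      by apply/andP; split; lra.
    move=> /andP[h1 h2].
    have [sp|ps] := leP s p; first by exists p, (s - p); split; rewrite /= ?in_itv /= ?ler_norml;
      lra.
    have [sq|qs] := leP s q; first by exists s, 0; split; rewrite /= ?in_itv /= ?ler_norml; lra.
    by exists q, (s - q); split; rewrite /= ?in_itv /= ?ler_norml; lra.
  have /= -> := lebesgue_measure_itv `[p - x, q + x]; rewrite lte_fin.
  by case: ltP => h; rewrite -?EFinB; congr EFin; lra.
have I0 : `[p, q]%classic = thick `[p, q]%classic 0 :> set R.
  apply/seteqP; split => s; first by move=> Is; exists s, 0; rewrite normr0 addr0.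
  by move=> [a [b [Ia]]]; rewrite normr_le0 => /eqP -> ->; rewrite addr0.
rewrite [X in (_ + _ * X = X + _)%E](_ : _ = (q - p)%:E).
  by rewrite !thickE ?mulr_ge0// -!EFinM -!EFinD; congr EFin; lra.
by rewrite [in LHS]I0 thickE// mulr0 addr0.
Qed.

Lemma rV_addE m (x y : 'rV[R]_m) i : (x + y) 0 i = x 0 i + y 0 i.
Proof. by rewrite mxE. Qed.

Lemma rV_oppE m (x : 'rV[R]_m) i : (- x) 0 i = - x 0 i.
Proof. by rewrite mxE. Qed.

Lemma rV_scaleE m (a : R) (x : 'rV[R]_m) i : (a *: x) 0 i = a * x 0 i.
Proof. by rewrite mxE. Qed.

Definition rVE := (rV_addE, rV_oppE, rV_scaleE).

Lemma rV_closed_compact_preimage m (K : set 'rV[R]_m) (T : topologicalType) (f : T -> 'rV[R]_m) :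
  compact K -> continuous f -> closed (f @^-1` K).
Proof.
move=> cK cf; apply: closed_comp; first by move=> x _; exact: cf.
exact: compact_closed (@rV_hausdorff _ _) cK.
Qed.

Lemma consV_linear m (t x y : R) (v w : 'rV[R]_m) :
  t *: (consV (x, v : V m) : 'rV[R]_m.+1) + (1 - t) *: (consV (y, w : V m) : 'rV[R]_m.+1) =
  consV (t * x + (1 - t) * y, (t *: v + (1 - t) *: w) : V m).
Proof.
apply/rowP => i; rewrite !rVE; case: (unliftP ord0 i) => [j ->|->].
  by rewrite !consVS /= !rVE.
by rewrite !consV0.
Qed.

Lemma rsection_compact m (K : set 'rV[R]_m.+1) (x : R) : compact K ->
  compact (rsection K x).
Proof.
move=> cK; have [a a0 Ka] := compact_cube_subset cK.
apply: (@cube_compact _ _ a).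
  apply: (@rV_closed_compact_preimage _ K _ (fun y : 'rV[R]_m => consV (x, y : V m))) => //.
  apply: continuous_rV => i; case: (unliftP ord0 i) => [j ->|->].
    by under eq_fun do rewrite consVS /=; exact: coord_continuous.
  by under eq_fun do rewrite consV0 /=; exact: cst_continuous.
by move=> y /Ka H i; have := H (lift ord0 i); have := consVS (x, y : V m) i; rewrite /consV /= =>
  ->.
Qed.

Lemma rsection_convex m (K : set 'rV[R]_m.+1) (x : R) : convex_set K ->
  convex_set (rsection K x).
Proof.
move=> vK y z Ky Kz t t01; have := vK _ _ Ky Kz t t01.
have := consV_linear t x x y z; rewrite /consV /= => ->.
by rewrite (_ : t * x + (1 - t) * x = x) //; ring.
Qed.

Definition thicken m (K : set 'rV[R]_m) (t : R) (u : 'rV[R]_m) :=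
  minkowski K (seg (t *: u)).

Lemma thickenP m (K : set 'rV[R]_m) (t : R) (u z : 'rV[R]_m) : 0 <= t ->
  thicken K t u z <-> exists k s, [/\ K k, `|s| <= t & z = k + s *: u].
Proof.
move=> t0; split.
  move=> [k [_ [Kk [s [s1 ->]] ->]]]; exists k, (s * t); split => //.
    by rewrite normrM (ger0_norm t0) ler_piMl.
  by rewrite scalerA.
move=> [k [s [Kk st ->]]]; exists k, (s *: u); split => //.
have [t00|tn0] := eqVneq t 0.
  move: st; rewrite t00 normr_le0 => /eqP ->; exists 0.
  by rewrite normr0 ler01 !scale0r.
have tp : 0 < t by rewrite lt_neqAle eq_sym tn0.
exists (s / t); split; last by rewrite scalerA divfK.
by rewrite normrM normfV (gtr0_norm tp) ler_pdivrMr// mul1r.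
Qed.

Lemma thicken_compact m (K : set 'rV[R]_m) (t : R) (u : 'rV[R]_m) :
  compact K -> compact (thicken K t u).
Proof. by move=> cK; apply: minkowski_compact => //; exact: seg_compact. Qed.

Lemma shear_slice_compact m (K : set 'rV[R]_m.+1) (y w : 'rV[R]_m) : compact K ->
  compact [set s : R | K (consV (s, (y + s *: w) : V m))].
Proof.
move=> cK; have [a a0 Ka] := compact_cube_subset cK.
apply: (@subclosed_compact _ _ `[-a, a]%classic); [|exact: segment_compact|].
  apply: (@rV_closed_compact_preimage _ K _ (fun s : R => consV (s, (y + s *: w) : V m))) => //.
  apply: continuous_rV => i; case: (unliftP ord0 i) => [j ->|->].
    under eq_fun do rewrite consVS /= !rVE.
    move=> s; apply: cvgD; first exact: cvg_cst.
    by apply: cvgM; [exact: cvg_id|exact: cvg_cst].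
  by under eq_fun do rewrite consV0 /=; move=> s; exact: cvg_id.
by move=> s /= /Ka /(_ ord0); rewrite consV0 in_itv /= ler_norml.
Qed.

Lemma shear_slice_convex m (K : set 'rV[R]_m.+1) (y w : 'rV[R]_m) : convex_set K ->
  let I := [set s : R | K (consV (s, (y + s *: w) : V m))] in
  forall a b, I a -> I b -> forall t : R, 0 <= t <= 1 -> I (t * a + (1 - t) * b).
Proof.
move=> vK I a b Ia Ib t t01; have := vK _ _ Ia Ib t t01.
rewrite consV_linear /I /=; congr (K (consV (_, _))).
by apply/rowP => j; rewrite !rVE; ring.
Qed.

(** The choice of [w] makes the sheared lines parallel to [u], so adding the segment acts inside
    each line, with half-length [t * |u0|] in terms of the first coordinate. *)
Lemma shear_slice_thicken m (K : set 'rV[R]_m.+1) (t u0 : R) (y u' : 'rV[R]_m) :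
  u0 != 0 -> 0 <= t -> let w := u0^-1 *: u' in
  [set s : R | thicken K t (consV (u0, u' : V m)) (consV (s, (y + s *: w) : V m))] =
  thick [set s : R | K (consV (s, (y + s *: w) : V m))] (t * `|u0|).
Proof.
move=> u0n0 t0 w; apply/seteqP; split => s /=.
  move=> /(thickenP _ _ _ t0) [k [sg [Kk st e]]].
  exists (s - sg * u0), (sg * u0); split; [|by rewrite normrM ler_wpM2r|by rewrite subrK].
  rewrite /= (_ : consV _ = k :> 'rV[R]_m.+1) //.
  move/(canLR (addrK _)): e => <-; apply/rowP => i; rewrite !rVE.
  case: (unliftP ord0 i) => [j ->|->]; last by rewrite !consV0.
  by rewrite !consVS /= !rVE; field.
move=> [a [b [/= Ka bt ->]]]; apply/(thickenP _ _ _ t0).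
exists (consV (a, (y + a *: w) : V m)), (b / u0); split => //.
  by rewrite normrM normfV ler_pdivrMr ?normr_gt0.
apply/rowP => i; rewrite !rVE.
case: (unliftP ord0 i) => [j ->|->]; last by rewrite !consV0 /= divfK.
by rewrite !consVS /= !rVE; field.
Qed.

Lemma rsection_thicken m (K : set 'rV[R]_m.+1) (t x : R) (u' : 'rV[R]_m) : 0 <= t ->
  rsection (thicken K t (consV (0, u' : V m))) x = thicken (rsection K x) t u'.
Proof.
move=> t0; apply/seteqP; split => y.
  move=> /(thickenP _ _ _ t0) [k [s [Kk st e]]].
  apply/(thickenP _ _ _ t0); exists (y - s *: u'), s; split; rewrite ?subrK//.
  suff ek : consV (x, (y - s *: u') : V m) = k :> 'rV[R]_m.+1 by move: Kk; rewrite -ek.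
  have {}e : consV (x, y : V m) = k + s *: (consV (0 : R, u' : V m) : 'rV[R]_m.+1) := e.
  move/(canLR (addrK _)): e => <-; apply/rowP => i; rewrite !rVE.
  case: (unliftP ord0 i) => [j ->|->]; last by rewrite !consV0 mulr0 subr0.
  by rewrite !consVS /= !rVE.
move=> /(thickenP _ _ _ t0) [k [s [Kk st ->]]]; apply/(thickenP _ _ _ t0).
exists (consV (x, k : V m)), s; split => //.
apply: (etrans (y := consV (x, (k + s *: u') : V m) : 'rV[R]_m.+1)) => //.
apply/rowP => i; rewrite !rVE; case: (unliftP ord0 i) => [j ->|->].
  by rewrite !consVS /= !rVE.
by rewrite !consV0 mulr0 addr0.
Qed.

(* The volume of [K + t [-u, u]] is affine in [t].  If [u 0 0 != 0], Fubini along the lines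
   parallel to [u], reached by a volume preserving shear, reduces this to compact intervals;
   otherwise the first coordinate sections satisfy the identity by induction. *)
Lemma vol_thicken_affine m (K : set 'rV[R]_m) (t : R) (u : 'rV[R]_m) : 0 <= t ->
  compact K -> convex_set K ->
  (vol (thicken K t u) + t%:E * vol K = vol K + t%:E * vol (thicken K 1 u))%E.
Proof.
move=> t0; elim: m K u => [|m IH] K u cK vK.
  have E s : 0 <= s -> vol (thicken K s u) = vol K.
    move=> s0; congr vol; apply/seteqP; split => z.
      by move=> /(thickenP _ _ _ s0)[k [b [Kk _ _]]]; rewrite (_ : z = k)//; apply/rowP => -[].
    by move=> Kz; apply/(thickenP _ _ _ s0); exists z, 0; split; rewrite ?normr0//; apply/rowP =>
      -[].
  by rewrite !E.
have mK : measurable (K : set (V m.+1)) by exact: borel_compact.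
have mT s : measurable (thicken K s u : set (V m.+1)).
  by apply: borel_compact; exact: thicken_compact.
have [u0|u0] := eqVneq (u 0 0) 0.
  have -> : u = consV (0 : R, (\row_j u 0 (lift ord0 j)) : V m) by rewrite [LHS]consV_eta u0.
  set u' := (\row_j _) in mT *.
  have mT' s : measurable (thicken K s (consV (0 : R, u' : V m)) : set (V m.+1)).
    by apply: borel_compact; exact: thicken_compact.
  rewrite /vol -/vol -!ge0_integralZl //;
    try by [exact: measurable_vol_rsection|move=> *; exact: vol_ge0].
  rewrite -!ge0_integralD //;
    try by [exact: measurable_vol_rsection|move=> *; exact: vol_ge0|
      move=> *; apply: mule_ge0 => //; exact: vol_ge0|
      apply: measurable_funeM; exact: measurable_vol_rsection].
  apply: eq_integral => x _; rewrite !rsection_thicken//.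
  by apply: IH; [exact: rsection_compact|exact: rsection_convex].
have [mu muE] := vol_measure R m.
pose u' : 'rV[R]_m := \row_j u 0 (lift ord0 j).
pose w := (u 0 0)^-1 *: u'.
have uE : u = consV (u 0 0, u' : V m) by exact: consV_eta.
have [mF0 ->] := vol_fubini_shear w muE mK.
have [mFt ->] := vol_fubini_shear w muE (mT t).
have [mF1 ->] := vol_fubini_shear w muE (mT 1).
rewrite -!ge0_integralZl //.
rewrite -!ge0_integralD //;
  try by [move=> *; apply: mule_ge0 | apply: measurable_funeM].
apply: eq_integral => y _ /=.
have E s : 0 <= s -> _ := fun s0 => @shear_slice_thicken m K s (u 0 0) y u' u0 s0.
rewrite /= -uE -/w in E; rewrite !E // mul1r.
apply: lebesgue_measure_thick_affine => //; first exact: shear_slice_compact.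
exact: shear_slice_convex.
Qed.

End VolumeTheory.

(** * Euclidean geometry *)

Section Euclid.
Variable R : realType.

Definition dot m (x y : 'rV[R]_m) : R := \sum_i x 0 i * y 0 i.

Lemma dotC m (x y : 'rV[R]_m) : dot x y = dot y x.
Proof. by apply: eq_bigr => i _; rewrite mulrC. Qed.

Lemma dotDl m (x y z : 'rV[R]_m) : dot (x + y) z = dot x z + dot y z.
Proof. by rewrite -big_split; apply: eq_bigr => i _; rewrite mxE mulrDl. Qed.

Lemma dotZl m (a : R) (x y : 'rV[R]_m) : dot (a *: x) y = a * dot x y.
Proof. by rewrite mulr_sumr; apply: eq_bigr => i _; rewrite mxE mulrA. Qed.

Lemma dotNl m (x y : 'rV[R]_m) : dot (- x) y = - dot x y.
Proof. by rewrite -scaleN1r dotZl mulN1r. Qed.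

Lemma dotDr m (x y z : 'rV[R]_m) : dot z (x + y) = dot z x + dot z y.
Proof. by rewrite dotC dotDl !(dotC z). Qed.

Lemma dotZr m (a : R) (x y : 'rV[R]_m) : dot y (a *: x) = a * dot y x.
Proof. by rewrite dotC dotZl (dotC y). Qed.

Lemma dotNr m (x y : 'rV[R]_m) : dot y (- x) = - dot y x.
Proof. by rewrite dotC dotNl (dotC y). Qed.

Lemma dot0l m (x : 'rV[R]_m) : dot 0 x = 0.
Proof. by rewrite -(scale0r 0) dotZl mul0r. Qed.

Definition dotE := (dotDl, dotDr, dotZl, dotZr, dotNl, dotNr).

Lemma dot_ge0 m (x : 'rV[R]_m) : 0 <= dot x x.
Proof. by apply: sumr_ge0 => i _; rewrite -expr2 sqr_ge0. Qed.

Lemma enorm_ge0 m (x : 'rV[R]_m) : 0 <= enorm x.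
Proof. exact: sqrtr_ge0. Qed.

Lemma enormE m (x : 'rV[R]_m) : enorm x = Num.sqrt (dot x x).
Proof. by congr Num.sqrt; apply: eq_bigr => i _; rewrite expr2. Qed.

Lemma sqr_enorm m (x : 'rV[R]_m) : enorm x ^+ 2 = dot x x.
Proof. by rewrite enormE sqr_sqrtr// dot_ge0. Qed.

Lemma enormZ m (a : R) (x : 'rV[R]_m) : enorm (a *: x) = `|a| * enorm x.
Proof. by rewrite !enormE !dotE mulrA -expr2 sqrtrM ?sqr_ge0// sqrtr_sqr. Qed.

Lemma enorm0 m : enorm (0 : 'rV[R]_m) = 0.
Proof. by rewrite -(scale0r 0) enormZ normr0 mul0r. Qed.

Lemma enormN m (x : 'rV[R]_m) : enorm (- x) = enorm x.
Proof. by rewrite -scaleN1r enormZ normrN1 mul1r. Qed.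

Lemma coord_le_enorm m (x : 'rV[R]_m) i : `|x 0 i| <= enorm x.
Proof.
rewrite -(@ler_pXn2r _ 2) ?nnegrE ?enorm_ge0// sqr_enorm real_normK ?num_real//.
by rewrite /dot (bigD1 i)//= expr2 lerDl sumr_ge0// => j _; rewrite -expr2 sqr_ge0.
Qed.

Lemma enorm_eq0 m (x : 'rV[R]_m) : (enorm x == 0) = (x == 0).
Proof.
apply/idP/eqP => [/eqP x0|->]; last by rewrite enorm0.
by apply/rowP => i; rewrite mxE; apply/eqP; rewrite -normr_le0 -x0 coord_le_enorm.
Qed.

Lemma enorm_gt0 m (x : 'rV[R]_m) : (0 < enorm x) = (x != 0).
Proof. by rewrite lt_def enorm_ge0 andbT enorm_eq0. Qed.

Lemma dot_le_enorm m (x y : 'rV[R]_m) : dot x y <= enorm x * enorm y.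
Proof.
have [->|y0] := eqVneq y 0; first by rewrite dotC dot0l enorm0 mulr0.
have [->|x0] := eqVneq x 0; first by rewrite dot0l enorm0 mul0r.
have := dot_ge0 (enorm y *: x - enorm x *: y).
rewrite !dotE -!sqr_enorm (dotC y x).
have : 0 < enorm x * enorm y by rewrite mulr_gt0// enorm_gt0.
by move=> p H; rewrite -(ler_pM2l p); nra.
Qed.

Lemma normr_dot_le m (x y : 'rV[R]_m) : `|dot x y| <= enorm x * enorm y.
Proof. by rewrite ler_norml lerNl -dotNl -{1}(enormN x) !dot_le_enorm. Qed.

Lemma enormD m (x y : 'rV[R]_m) : enorm (x + y) <= enorm x + enorm y.
Proof.
rewrite -(@ler_pXn2r _ 2) ?nnegrE ?addr_ge0 ?enorm_ge0// sqr_enorm !dotE.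
have := dot_le_enorm x y; rewrite sqrrD !sqr_enorm (dotC y x); nra.
Qed.

Lemma enormB m (x y : 'rV[R]_m) : enorm (x - y) = enorm (y - x).
Proof. by rewrite -enormN opprB. Qed.

Lemma enormDB m (x y : 'rV[R]_m) : enorm x - enorm y <= enorm (x - y).
Proof. by rewrite lerBlDr -{1}(subrK y x) enormD. Qed.

Lemma enorm_le_sum m (x : 'rV[R]_m) : enorm x <= \sum_i `|x 0 i|.
Proof.
have S0 : 0 <= \sum_i `|x 0 i| by apply: sumr_ge0.
rewrite -(@ler_pXn2r _ 2) ?nnegrE ?enorm_ge0// sqr_enorm expr2 mulr_suml.
apply: ler_sum => i _; rewrite -expr2 -(real_normK (num_real _)) expr2 ler_wpM2l//.
by rewrite (bigD1 i)//= lerDl sumr_ge0.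
Qed.

Lemma enorm_le_cube m (x : 'rV[R]_m) (a : R) : cube m a x -> enorm x <= a *+ m.
Proof.
move=> xa; apply: le_trans (enorm_le_sum x) _.
by rewrite -[m in leRHS]card_ord -sumr_const; apply: ler_sum.
Qed.

Lemma dot_continuous m (x : 'rV[R]_m) : continuous (fun y => dot y x).
Proof.
rewrite (_ : (fun y => dot y x) = \sum_i (fun y : 'rV[R]_m => y 0 i * x 0 i)); last first.
  by apply/funext => y; rewrite fct_sumE; apply: eq_bigr.
elim/big_ind : _ => [|f g cf cg|i _] y.
- exact: (@cst_continuous _ _ (0 : R) y).
- exact: (cvgD (cf y) (cg y)).
- exact: (cvgM (@coord_continuous R 1 m 0 i y) (cvg_cst (x 0 i))).
Qed.

Lemma enorm_nbhs m (x : 'rV[R]_m) (e : R) : 0 < e -> \forall y \near x, enorm (y - x) < e.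
Proof.
move=> e0; apply/nbhs_ballP; exists (e / m.+1%:R); first by rewrite /= divr_gt0.
move=> y [_ H]; apply: (@le_lt_trans _ _ ((e / m.+1%:R) *+ m)).
  apply: enorm_le_cube => i; have := H 0 i; rewrite /ball /= => /ltW.
  by rewrite rVE rV_oppE distrC.
by rewrite -mulr_natr -mulrA mulrC -[ltRHS]mul1r ltr_pM2r// mulrC ltr_pdivrMr// mul1r ltr_nat.
Qed.

Lemma nbhs_enormP m (x : 'rV[R]_m) (U : set 'rV[R]_m) :
  nbhs x U <-> exists2 e : R, 0 < e & forall y, enorm (y - x) < e -> U y.
Proof.
split => [/nbhs_ballP[e /= e0 xU]|[e e0 H]]; last first.
  exact: (@filterS _ (nbhs x) (nbhs_filter x) _ _ H (enorm_nbhs x e0)).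
exists e => // y yx; apply: xU; split => // i j; rewrite (ord1 i) /ball /=.
apply: le_lt_trans yx; rewrite distrC; apply: le_trans (coord_le_enorm _ j).
by rewrite rVE rV_oppE.
Qed.

Lemma enorm_continuous m : continuous (@enorm R m).
Proof.
move=> x; apply/(@cvgrPdist_lt _ _ _ (nbhs x) (nbhs_filter x)) => e e0.
apply: (@filterS _ (nbhs x) (nbhs_filter x) _ _ _ (enorm_nbhs x e0)) => y; apply: le_lt_trans.
rewrite ler_norml; have := enormDB x y; have := enormDB y x; rewrite (enormB x y) => *.
by apply/andP; split; lra.
Qed.

Lemma edistC m (x y : 'rV[R]_m) : edist x y = edist y x.
Proof. exact: enormB. Qed.

Lemma euclid_dist_continuous m (c : 'rV[R]_m) : continuous (fun x => edist x c).
Proof.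
move=> x; apply: (@cvg_comp _ _ _ (fun x => x - c) (@enorm R m) _ (nbhs (x - c))).
  exact: (cvgB cvg_id (cvg_cst c)).
exact: enorm_continuous.
Qed.

Lemma cball_closed m (c : 'rV[R]_m) (r : R) : closed (cball c r).
Proof.
apply: (@closed_comp _ _ (fun x => edist x c) [set y | y <= r]); last exact: closed_le.
by move=> x _; exact: euclid_dist_continuous.
Qed.

Lemma cball_compact m (c : 'rV[R]_m) (r : R) : compact (cball c r).
Proof.
apply: (@cube_compact _ _ _ (r + enorm c)); first exact: cball_closed.
move=> x xc i; apply: le_trans (coord_le_enorm x i) _.
by move: xc; rewrite /cball /= /edist; have := enormDB x c; lra.
Qed.

Lemma cball_convex m (c : 'rV[R]_m) (r : R) : convex_set (cball c r).
Proof.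
move=> x y; rewrite /cball /edist /= => xc yc t /andP[t0 t1].
have -> : t *: x + (1 - t) *: y - c = t *: (x - c) + (1 - t) *: (y - c).
  by apply/rowP => i; rewrite !rVE; ring.
apply: le_trans (enormD _ _) _; rewrite !enormZ !ger0_norm ?subr_ge0//.
by nra.
Qed.

Lemma scale_cballE m (t : R) : 0 <= t ->
  scale_set t (cball (0 : 'rV[R]_m) 1) = cball 0 t.
Proof.
move=> t0; apply/seteqP; split => x; rewrite /cball /edist /= ?subr0.
  by move=> [a [/=]]; rewrite /edist subr0 => a1 ->; rewrite enormZ ger0_norm// ler_piMr.
move=> xt; have [t00|tn0] := eqVneq t 0.
  move: xt; rewrite t00 => x0; exists 0; rewrite /= /edist subrr enorm0 scale0r; split => //.
  by apply/eqP; rewrite -enorm_eq0 eq_le x0 enorm_ge0.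
have tp : 0 < t by rewrite lt_neqAle eq_sym tn0.
exists (t^-1 *: x); split; last by rewrite scalerA divff// scale1r.
by rewrite /= /edist subr0 enormZ normfV gtr0_norm// mulrC ler_pdivrMr// mul1r.
Qed.

(* For [v = 0] the division by zero gives [refl 0 x = x]. *)
Definition refl m (v x : 'rV[R]_m) : 'rV[R]_m := x - (2 * dot x v / dot v v) *: v.

Lemma refl_dot m (v x y : 'rV[R]_m) : dot (refl v x) (refl v y) = dot x y.
Proof.
rewrite /refl; have [->|v0] := eqVneq v 0; first by rewrite !scaler0 !subr0.
have vv : dot v v != 0 by rewrite -sqr_enorm expf_neq0// enorm_eq0.
by rewrite !dotE (dotC v y); field.
Qed.

Lemma enorm_refl m (v x : 'rV[R]_m) : enorm (refl v x) = enorm x.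
Proof. by rewrite !enormE refl_dot. Qed.

Lemma reflD m (v x y : 'rV[R]_m) : refl v (x + y) = refl v x + refl v y.
Proof. by apply/rowP => i; rewrite /refl !dotE !rVE; ring. Qed.

Lemma reflZ m (v x : 'rV[R]_m) (a : R) : refl v (a *: x) = a *: refl v x.
Proof. by apply/rowP => i; rewrite /refl !dotE !rVE; ring. Qed.

Lemma reflN m (v x : 'rV[R]_m) : refl v (- x) = - refl v x.
Proof. by rewrite -scaleN1r reflZ scaleN1r. Qed.

Lemma reflB m (v x y : 'rV[R]_m) : refl v (x - y) = refl v x - refl v y.
Proof. by rewrite reflD reflN. Qed.

Lemma reflK m (v : 'rV[R]_m) : involutive (refl v).
Proof.
move=> x; rewrite /refl; have [->|v0] := eqVneq v 0; first by rewrite !scaler0 !subr0.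
have vv : dot v v != 0 by rewrite -sqr_enorm expf_neq0// enorm_eq0.
by apply/rowP => i; rewrite !dotE !rVE; field.
Qed.

Lemma refl_dotC m (v x y : 'rV[R]_m) : dot (refl v x) y = dot x (refl v y).
Proof. by rewrite -(refl_dot v x) reflK. Qed.

(** The reflection in the perpendicular bisector of [x] and [y]; for [x = y] the convention on
    [refl 0] gives the identity. These maps supply all the isometries fixing [0] that are used. *)
Lemma refl_swap m (x y : 'rV[R]_m) : enorm x = enorm y -> refl (x - y) x = y.
Proof.
move=> xy; have [e|nxy] := eqVneq (x - y) 0.
  by rewrite /refl e scaler0 subr0; apply/eqP; rewrite -subr_eq0 e.
have vv : dot (x - y) (x - y) != 0 by rewrite -sqr_enorm expf_neq0// enorm_eq0.
rewrite /refl (_ : _ / _ = 1); first by rewrite scale1r subKr.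
apply/eqP; rewrite -(inj_eq (mulIf vv)) divfK// mul1r; apply/eqP.
by rewrite !dotE (dotC y x) -!sqr_enorm xy; ring.
Qed.

Lemma refl_continuous m (v : 'rV[R]_m) : continuous (refl v).
Proof.
apply: continuous_rV => i; rewrite /refl; under eq_fun do rewrite !rVE.
move=> x; apply: (cvgB (@coord_continuous R 1 m 0 i x)).
apply: cvgM (cvg_cst (v 0 i)); apply: cvgM (cvg_cst _).
exact: (cvgM (cvg_cst (2 : R)) (@dot_continuous _ v x)).
Qed.

End Euclid.

(** * Invariance of the volume under reflections *)

Section Reflection.
Variable R : realType.
Notation V := (borelV R).

Lemma measurable_continuous m (f : 'rV[R]_m -> 'rV[R]_m) (A : set (V m)) :
  continuous f -> measurable A -> measurable (f @^-1` A : set (V m)).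
Proof.
move=> cf mA; have mf : measurable_fun setT (f : V m -> V m).
  apply: (@measurability _ _ _ (V m) _ _ (@open 'rV[R]_m)) => //.
  move=> _ [U oU <-]; rewrite setTI; apply: borel_open.
  by apply: open_comp => // x _; exact: cf.
by rewrite -[X in measurable X]setTI; exact: mf.
Qed.

Lemma measurable_add_pair m (f g : R) (A : set (V m)) : measurable A ->
  measurable [set p : V m * V m | A (f *: (p.1 : 'rV[R]_m) + g *: (p.2 : 'rV[R]_m))].
Proof.
move=> mA; have mf : measurable_fun setT (fun p : V m * V m => (f *: (p.1 : 'rV[R]_m) + g *:
  (p.2 : 'rV[R]_m) : V m)).
  apply: measurable_fun_rV => i; under eq_fun do rewrite !rVE.
  apply: measurable_funD; apply: measurable_funM => //.
    by apply: (measurableT_comp (measurable_coord i)); exact: measurable_fst.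
  by apply: (measurableT_comp (measurable_coord i)); exact: measurable_snd.
by rewrite -[X in measurable X]setTI; exact: mf.
Qed.

Lemma vol_cball_gt0 m (r : R) : 0 < r -> (0 < vol (cball (0 : 'rV[R]_m) r))%E.
Proof.
move=> r0; apply: (@lt_le_trans _ _ (vol (cube m (r / m.+1%:R)))).
  by rewrite vol_cube ?divr_ge0// ?(ltW r0)// lte_fin exprn_gt0// mulr_gt0// divr_gt0.
apply: le_vol; [by apply: borel_closed; exact: closed_cube|by apply: borel_closed; exact:
  cball_closed|].
move=> x /enorm_le_cube; rewrite /cball /edist /= subr0 => /le_trans; apply.
by rewrite -[_ *+ m]mulr_natr mulrAC ler_pdivrMr// ler_pM2l// ler_nat.
Qed.

Lemma vol_cball_lty m (c : 'rV[R]_m) (r : R) : (vol (cball c r) < +oo)%E.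
Proof.
have [a _ Ha] := compact_cube_subset (@cball_compact R m c r).
by apply: vol_lty Ha; apply: borel_closed; exact: cball_closed.
Qed.

(* Both sides are [(mu x nu) {(x, y) | A (x + y) /\ B y}], computed in the two orders of
   integration. *)
Lemma translation_invariant_proportional m (mu nu : {sigma_finite_measure set (V m) -> \bar R})
    (A B : set (V m)) :
  (forall (X : set (V m)) a, measurable X -> mu [set x : 'rV[R]_m | X (x + a)] = mu X) ->
  (forall (X : set (V m)) a, measurable X -> nu [set x : 'rV[R]_m | X (x + a)] = nu X) ->
  measurable A -> measurable B -> (forall x : 'rV[R]_m, B x -> B (- x)) ->
  (mu A * nu B = mu B * nu A)%E.
Proof.
move=> muT nuT mA mB symB.
have symB' (x : 'rV[R]_m) : B (- x) <-> B x.
  by split; [move=> /symB; rewrite opprK|exact: symB].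
pose add (p : V m * V m) : 'rV[R]_m := 1 *: (p.1 : 'rV[R]_m) + 1 *: (p.2 : 'rV[R]_m).
pose sub (p : V m * V m) : 'rV[R]_m := (-1) *: (p.1 : 'rV[R]_m) + 1 *: (p.2 : 'rV[R]_m).
pose E := [set p : V m * V m | A (add p)] `&` (setT `*` B).
pose E' := [set p : V m * V m | B (sub p)] `&` (setT `*` A).
have mE : measurable E.
  by apply: measurableI; [exact: measurable_add_pair|exact: measurableX].
have mE' : measurable E'.
  by apply: measurableI; [exact: measurable_add_pair|exact: measurableX].
have tonelli X : measurable X -> (\int[mu]_x nu (xsection X x) = \int[nu]_y mu (ysection X y))%E.
  move=> mX; apply: (product_measure_unique (m' := (mu \x^ nu)%E) _ mX).
  by move=> *; exact: product_measure2E.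
have int_cst (C D : set (V m)) : measurable D ->
    (\int[nu]_y (mu C * (\1_D y)%:E) = mu C * nu D)%E.
  move=> mD; rewrite ge0_integralZl// ?integral_indic ?setIT//.
  by apply/measurable_EFinP; exact: measurable_indic.
rewrite -(int_cst A B mB) -(int_cst B A mA).
transitivity (\int[nu]_y mu (ysection E y))%E.
  apply: eq_integral => y _; rewrite indicE.
  have [By|nBy] := boolP (y \in B).
    rewrite mule1 -(muT A (y : 'rV[R]_m) mA); congr (mu _); apply/seteqP.
    rewrite inE in By.
    by split => x; rewrite ysectionE /E /add /= !scale1r; [split|case].
  rewrite mule0 -(measure0 mu); congr (mu _); apply/seteqP; split => // x.
  by rewrite ysectionE => -[_ [_ /= By]]; move: nBy; rewrite notin_setE.
rewrite -tonelli//.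
transitivity (\int[mu]_x nu (xsection E' x))%E.
  apply: eq_integral => x _.
  have mEx : measurable (xsection E x) by exact: measurable_xsection.
  rewrite -(nuT _ (- (x : 'rV[R]_m)) mEx); congr (nu _); apply/seteqP.
  split => y; rewrite !xsectionE /E /E' /add /sub /= !scale1r scaleN1r.
    by rewrite addrC subrK addrC => -[Ay [_ By]].
  by move=> [By [_ Ay]]; rewrite addrC subrK; split => //; split => //; rewrite addrC.
rewrite tonelli//; apply: eq_integral => y _; rewrite indicE.
have [Ay|nAy] := boolP (y \in A).
  rewrite mule1 -(muT B (- (y : 'rV[R]_m)) mB); congr (mu _); apply/seteqP.
  rewrite inE in Ay.
  split => x; rewrite ysectionE /E' /sub /= !scale1r scaleN1r.
    by move=> [/symB' + _]; rewrite opprD opprK.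
  by move=> /symB'; rewrite opprB addrC; split.
rewrite mule0 -(measure0 mu); congr (mu _); apply/seteqP; split => // x.
by rewrite ysectionE => -[_ [_ /= Ay]]; move: nAy; rewrite notin_setE.
Qed.

(** By linearity of the reflection, the pushforward of [vol] is again translation invariant, hence
    proportional to [vol]. The unit ball is preserved and has positive finite volume, so the factor
    is one. *)
Lemma vol_refl m (v : 'rV[R]_m) (A : set (V m)) : measurable A ->
  vol (refl v @^-1` A : set 'rV[R]_m) = vol (A : set 'rV[R]_m).
Proof.
move=> mA; have [mu muE] := vol_measure R m.
have mr (X : set (V m)) : measurable X -> measurable (refl v @^-1` X : set (V m)).
  by apply: measurable_continuous; exact: refl_continuous.
have mrefl : measurable_fun setT (refl v : V m -> V m).
  by move=> _ X mX; rewrite setTI; exact: mr.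
pose nu0 : {measure set (V m) -> \bar R} :=
  measure_function_pushforward__canonical__measure_function_Measure mu mrefl.
pose B : set (V m) := cball (0 : 'rV[R]_m) 1.
have reflcube (k : nat) : exists2 a : R, 0 <= a & refl v @^-1` cube m k%:R `<=` cube m a.
  exists (k%:R *+ m); first by rewrite mulrn_wge0.
  move=> x /= H i; apply: le_trans (coord_le_enorm x i) _.
  by rewrite -(enorm_refl v); exact: enorm_le_cube.
have nu0_fin : sigma_finite setT nu0.
  exists (fun k => cube m k%:R); first by rewrite cube_cover.
  have mc k : measurable (cube m k%:R : set (V m)).
    by apply: borel_closed; exact: closed_cube.
  move=> k; split => //.
  have [a a0 Ha] := reflcube k.
  by rewrite /nu0 /= /pushforward muE; apply: vol_lty Ha; exact: mr.
have [nu nuE] := sigma_finite_measure_pack (measure0 nu0) (measure_ge0 nu0)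
  (@measure_semi_sigma_additive _ _ _ nu0) nu0_fin.
have nuX (X : set (V m)) : nu X = vol (refl v @^-1` X : set 'rV[R]_m).
  by rewrite nuE /nu0 /= /pushforward muE.
have mB : measurable B by apply: borel_closed; exact: cball_closed.
have symB (x : 'rV[R]_m) : B x -> B (- x).
  by rewrite /B /cball /edist /= !subr0 enormN.
have := @translation_invariant_proportional m mu nu A B _ _ mA mB symB.
rewrite !nuX muE.
have -> : refl v @^-1` B = B.
  by apply/seteqP; split => x; rewrite /B /cball /edist /= !subr0 enorm_refl.
move=> /(_ _ _)/wrap[| |H].
- by move=> X a mX; exact: vol_shift.
- move=> X a mX; rewrite !nuX -(vol_shift (refl v a) (mr _ mX)); congr vol.
  by apply/seteqP; split => x /=; rewrite reflD reflK.
move: H (vol_cball_gt0 m (ltr01 : (0 : R) < 1)) (vol_cball_lty (0 : 'rV[R]_m) 1); rewrite -/B.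
case: (vol B) => // b; rewrite lte_fin => H b0 _.
have K (x : \bar R) : (b^-1%:E * (b%:E * x) = x)%E.
  by rewrite muleA -EFinM mulVf ?mul1e// gt_eqF.
by rewrite -[LHS]K -H [X in (_ * X)%E]muleC K.
Qed.

End Reflection.

(** * Steiner polynomials *)

Section Steiner.
Variable R : realType.
Variable m : nat.
Implicit Types (K L : set 'rV[R]_m) (F : set 'rV[R]_m -> R) (us : seq 'rV[R]_m).

Definition compact_convex K := compact K /\ convex_set K.

Definition rvol K : R := fine (vol K).

Lemma vol_rvol K : compact K -> vol K = (rvol K)%:E.
Proof.
move=> cK; rewrite /rvol fineK// ge0_fin_numE ?vol_ge0//.
have [a _ Ka] := compact_cube_subset cK.
by apply: vol_lty Ka; exact: borel_compact.
Qed.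

Lemma le_rvol K L : compact K -> compact L -> K `<=` L -> rvol K <= rvol L.
Proof.
move=> cK cL KL; rewrite -lee_fin -!vol_rvol//.
by apply: le_vol => //; exact: borel_compact.
Qed.

Lemma minkowski_cc K L :
  compact_convex K -> compact_convex L -> compact_convex (minkowski K L).
Proof.
by move=> [cK vK] [cL vL]; split; [exact: minkowski_compact|exact: minkowski_convex].
Qed.

Lemma seg_cc (u : 'rV[R]_m) : compact_convex (seg u).
Proof. by split; [exact: seg_compact|exact: seg_convex]. Qed.

Lemma cball_cc (c : 'rV[R]_m) (r : R) : compact_convex (cball c r).
Proof. by split; [exact: cball_compact|exact: cball_convex]. Qed.

Lemma sub_minkowski_seg K (u : 'rV[R]_m) : K `<=` minkowski K (seg u).
Proof.
move=> x Kx; exists x, 0; split; rewrite ?addr0//.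
by exists 0; rewrite normr0 scale0r ler01.
Qed.

(** Exactly what is inherited by the difference [seg_diff u F], so that an induction on the list of
    segments can start from [rvol]. *)
Definition regular F := [/\ (forall K, compact_convex K -> 0 <= F K),
  (forall K L, compact_convex K -> compact_convex L -> K `<=` L -> F K <= F L) &
  (forall K u t, compact_convex K -> 0 <= t ->
     F (minkowski K (seg (t *: u))) = F K + t * (F (minkowski K (seg u)) - F K))].

Definition seg_diff (u : 'rV[R]_m) F : set 'rV[R]_m -> R :=
  fun K => F (minkowski K (seg u)) - F K.

Lemma regular_rvol : regular rvol.
Proof.
split=> [K _|K L [cK _] [cL _]|K u t [cK vK] t0]; first by rewrite fine_ge0// vol_ge0.
  exact: le_rvol.
have := vol_thicken_affine u t0 cK vK; rewrite /thicken scale1r.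
rewrite !vol_rvol //; try by apply: minkowski_compact => //; exact: seg_compact.
by rewrite -!EFinM -!EFinD => -[]; lra.
Qed.

Lemma regular_seg_diff u F : regular F -> regular (seg_diff u F).
Proof.
move=> [F0 Fm Fa]; split.
- move=> K cK; rewrite subr_ge0; apply: Fm => //; last exact: sub_minkowski_seg.
  by apply: minkowski_cc => //; exact: seg_cc.
- move=> K L cK cL KL; rewrite /seg_diff leNgt; apply/negP => lt.
  (* [F K + t * seg_diff u F K <= F L + t * seg_diff u F L] for all [t >= 0]: let [t] grow *)
  have H t : 0 <= t -> F K + t * (F (minkowski K (seg u)) - F K) <=
      F L + t * (F (minkowski L (seg u)) - F L).
    move=> t0; rewrite -!Fa//; apply: Fm; try by apply: minkowski_cc => //; exact: seg_cc.
    by apply: minkowskiS.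
  set dK := F (minkowski K (seg u)) - F K in lt H *.
  set dL := F (minkowski L (seg u)) - F L in lt H *.
  have d0 : 0 < dK - dL by rewrite subr_gt0.
  have t0 : 0 <= (F L - F K + 1) / (dK - dL).
    by rewrite divr_ge0 ?(ltW d0)// addr_ge0// subr_ge0; exact: Fm.
  have := H _ t0; set t := _ / _ => Ht.
  have : t * (dK - dL) = F L - F K + 1 by rewrite divfK// gt_eqF.
  by rewrite mulrBr; lra.
- move=> K v t cK t0; rewrite /seg_diff.
  have cKu : compact_convex (minkowski K (seg u)) by apply: minkowski_cc => //; exact: seg_cc.
  (* The segments of [u] and [v] can be added in either order, so the affinity of [F] along [v]
     applies both to [K] and to [K + seg u]. *)
  rewrite -minkowskiA (minkowskiC (seg (t *: v))) minkowskiA Fa// Fa//.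
  by rewrite -[in RHS]minkowskiA (minkowskiC (seg v)) minkowskiA; ring.
Qed.

Fixpoint zonotope us : set 'rV[R]_m :=
  if us is u :: us' then minkowski (seg u) (zonotope us') else [set 0].

Definition scaled (t : R) us := [seq t *: u | u <- us].

Lemma zonotope_cc us : compact_convex (zonotope us).
Proof.
elim: us => [|u us IH] /=; last by apply: minkowski_cc => //; exact: seg_cc.
split; first exact: compact_set1.
by move=> x y -> -> t _; rewrite /= !scaler0 addr0.
Qed.

(* The [F]-volume of [K + t Z] as a polynomial in [t]: its coefficients are sums of iterated
   differences [seg_diff u1 (seg_diff u2 ...) F K], hence monotone in [K]. *)
Fixpoint zonotope_poly us F K : {poly R} :=
  if us is u :: us' then
    zonotope_poly us' F K + 'X * zonotope_poly us' (seg_diff u F) K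
  else (F K)%:P.

Lemma zonotope_polyE us F K t : regular F -> compact_convex K -> 0 <= t ->
  F (minkowski K (zonotope (scaled t us))) = (zonotope_poly us F K).[t].
Proof.
elim: us F K => [|u us IH] F K rF cK t0 /=.
  rewrite hornerC; congr F; apply/seteqP; split => x.
    by move=> [k [_ [Kk -> ->]]]; rewrite addr0.
  by move=> Kx; exists x, 0; rewrite addr0.
have cKZ : compact_convex (minkowski K (zonotope (scaled t us))).
  by apply: minkowski_cc => //; exact: zonotope_cc.
rewrite (minkowskiC (seg _)) minkowskiA; have [_ _ ->] := rF => //.
rewrite hornerD hornerM hornerX -!IH//; exact: regular_seg_diff.
Qed.

Lemma zonotope_poly_coef_ge0 us F K i : regular F -> compact_convex K ->
  0 <= (zonotope_poly us F K)`_i.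
Proof.
elim: us F i => [|u us IH] F i rF cK /=.
  by rewrite coefC; case: eqP => // _; have [F0 _ _] := rF; exact: F0.
rewrite coefD coefXM addr_ge0 ?IH//; case: eqP => // _.
by apply: IH => //; exact: regular_seg_diff.
Qed.

Lemma zonotope_poly_coef_le us F K L i : regular F ->
  compact_convex K -> compact_convex L -> K `<=` L ->
  (zonotope_poly us F K)`_i <= (zonotope_poly us F L)`_i.
Proof.
move=> + cK cL KL; elim: us F i => [|u us IH] F i rF /=.
  by rewrite !coefC; case: eqP => // _; have [_ Fm _] := rF; exact: Fm.
rewrite !coefD !coefXM lerD ?IH//; case: eqP => // _.
by apply: IH => //; exact: regular_seg_diff.
Qed.

Lemma zonotope_scaledE us t : zonotope (scaled t us) = scale_set t (zonotope us).
Proof.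
elim: us => [|u us IH] /=.
  apply/seteqP; split => x; first by move=> ->; exists 0; rewrite scaler0.
  by move=> [_ [-> ->]]; rewrite scaler0.
rewrite IH; apply/seteqP; split => x.
  move=> [_ [_ [[s [s1 ->]] [z [Zz ->]] ->]]]; exists (s *: u + z); split.
    by exists (s *: u), z; split => //; exists s.
  by rewrite scalerDr !scalerA mulrC.
move=> [_ [[_ [z [[s [s1 ->]] Zz ->]]] ->]].
exists (s *: (t *: u)), (t *: z); split.
- by exists s.
- by exists z.
- by rewrite scalerDr !scalerA mulrC.
Qed.

Lemma poly_coef_le_horner (p : {poly R}) i (t : R) : (forall j, 0 <= p`_j) -> 0 <= t ->
  p`_i * t ^+ i <= p.[t].
Proof.
move=> p0 t0; rewrite horner_coef.
have [ip|pi] := ltnP i (size p); last first.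
  by rewrite nth_default// mul0r; apply: sumr_ge0 => j _; rewrite mulr_ge0// exprn_ge0.
rewrite (bigD1 (Ordinal ip))//= lerDl; apply: sumr_ge0 => j _.
by rewrite mulr_ge0// exprn_ge0.
Qed.

(** For [t >= 1] the body [K + t Z] lies in a cube of half-side [(a + b) * t], so its volume is at
    most a constant times [t ^+ m]. As no coefficient is negative, a positive one of higher degree
    could not be compensated. *)
Lemma size_zonotope_poly us K : compact_convex K ->
  (size (zonotope_poly us rvol K) <= m.+1)%N.
Proof.
move=> cK; apply/leq_sizeP => i mi; set p := zonotope_poly _ _ _.
have p0 j : 0 <= p`_j by apply: zonotope_poly_coef_ge0 => //; exact: regular_rvol.
apply/eqP; rewrite eq_le p0 andbT leNgt; apply/negP => pi.
have [a a0 Ka] := compact_cube_subset (proj1 cK).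
have [b b0 Zb] := compact_cube_subset (proj1 (zonotope_cc us)).
have C0 : 0 <= (2 * (a + b)) ^+ m by rewrite exprn_ge0// mulr_ge0// addr_ge0.
have H t : 1 <= t -> p`_i * t <= (2 * (a + b)) ^+ m.
  move=> t1; have t0 : 0 < t by rewrite (lt_le_trans _ t1).
  rewrite -(ler_pM2r (exprn_gt0 m t0)) -mulrA -exprS.
  apply: (@le_trans _ _ (p`_i * t ^+ i)).
    by rewrite ler_wpM2l// ler_weXn2l.
  apply: le_trans (poly_coef_le_horner i p0 (ltW t0)) _.
  rewrite -zonotope_polyE//; [|exact: regular_rvol|exact: ltW].
  rewrite -exprMn -mulrA -lee_fin -vol_rvol; last first.
    by apply: minkowski_compact; [exact: (proj1 cK)|exact: (proj1 (zonotope_cc _))].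
  rewrite -vol_cube; last by rewrite mulr_ge0 ?(ltW t0)// addr_ge0.
  apply: le_vol.
  - apply: borel_compact; apply: minkowski_compact; [exact: (proj1 cK)|exact:
    (proj1 (zonotope_cc _))].
  - by apply: borel_closed; exact: closed_cube.
  rewrite zonotope_scaledE => x [k [_ [Kk [z [Zz ->]] ->]]] j.
  rewrite rVE rV_scaleE; apply: le_trans (ler_normD _ _) _.
  rewrite mulrDl lerD//; first by rewrite (le_trans (Ka _ Kk j))// ler_peMr.
  by rewrite normrM gtr0_norm// mulrC ler_wpM2r ?(ltW t0)//; exact: Zb.
(* At this [t] the product with the coefficient equals the supposed bound plus the positive
   coefficient itself. *)
have := H (1 + (2 * (a + b)) ^+ m / p`_i).
rewrite lerDl divr_ge0 ?(ltW pi)// => /(_ isT).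
by rewrite mulrDr mulr1 mulrC divfK ?gt_eqF//; lra.
Qed.

Definition nat_lagrange (j : 'I_m.+1) : {poly R} :=
  tnth (lagrange m.+1 (fun k : nat => k%:R : R)) j.

(** With the nodes fixed, each coefficient is a fixed linear combination of [m + 1] values;
    pointwise convergence therefore implies convergence of coefficients, and agreement at the nodes
    implies equality. *)
Lemma poly_lagrange (p : {poly R}) : (size p <= m.+1)%N ->
  p = \sum_(j < m.+1) p.[j%:R] *: nat_lagrange j.
Proof.
have x_inj : injective (fun k : nat => k%:R : R) by move=> i j /eqP; rewrite eqr_nat => /eqP.
move=> /(lagrange_gen (ltn0Sn m) x_inj) {1}->.
by apply: eq_bigr => j _; rewrite mul_polyC.
Qed.

(* The candidate for [t |-> vol (K + t B)], interpolated from its values at [0, ..., m]. *)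
Definition ball_poly K : {poly R} := \sum_(j < m.+1) rvol (minkowski K (cball 0 j%:R)) *:
  nat_lagrange j.

Definition ball_zonotopes (us : nat -> seq 'rV[R]_m) := forall k,
  cball 0 1 `<=` zonotope (us k) /\ zonotope (us k) `<=` cball 0 (1 + k.+1%:R^-1).

Lemma scale_cballM (t r : R) : 0 <= t -> 0 <= r ->
  scale_set t (cball (0 : 'rV[R]_m) r) = cball 0 (t * r).
Proof.
move=> t0 r0; rewrite -(scale_cballE m r0) -(scale_cballE m (mulr_ge0 t0 r0)).
apply/seteqP; split => x.
  by move=> [_ [[y [y1 ->]] ->]]; exists y; rewrite scalerA.
by move=> [y [y1 ->]]; exists (r *: y); rewrite scalerA; split => //; exists y.
Qed.

Lemma scale_setS (t : R) K L : K `<=` L -> scale_set t K `<=` scale_set t L.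
Proof. by move=> KL x [y [/KL Ly ->]]; exists y. Qed.

(* The upper bound follows from [p.[t] <= (1 + e) ^+ m * p.[t / (1 + e)]], valid because
   [p] has nonnegative coefficients and degree at most [m]. *)
Lemma zonotope_poly_ball us K (e t : R) : compact_convex K -> 0 < e -> 0 <= t ->
  cball 0 1 `<=` zonotope us -> zonotope us `<=` cball 0 (1 + e) ->
  rvol (minkowski K (cball 0 t)) <= (zonotope_poly us rvol K).[t] <=
    (1 + e) ^+ m * rvol (minkowski K (cball 0 t)).
Proof.
move=> cK e0 t0 BZ ZB; have e1 : 0 < 1 + e by rewrite addr_gt0.
have te : 0 <= t / (1 + e) by rewrite divr_ge0// ltW.
have cc s : compact_convex (minkowski K (zonotope (scaled s us))).
  by apply: minkowski_cc => //; exact: zonotope_cc.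
have ccb s : compact_convex (minkowski K (cball 0 s)).
  by apply: minkowski_cc => //; exact: cball_cc.
apply/andP; split.
  rewrite -zonotope_polyE//; last exact: regular_rvol.
  apply: le_rvol; [exact: (proj1 (ccb _))|exact: (proj1 (cc _))|].
  by apply: minkowskiS => //; rewrite zonotope_scaledE -scale_cballE//; exact: scale_setS.
apply: (@le_trans _ _ ((1 + e) ^+ m * (zonotope_poly us rvol K).[t / (1 + e)])).
  set p := zonotope_poly _ _ _.
  rewrite !(horner_coef_wide _ (size_zonotope_poly us cK)) mulr_sumr.
  apply: ler_sum => i _; rewrite mulrCA ler_wpM2l//.
    by apply: zonotope_poly_coef_ge0 => //; exact: regular_rvol.
  rewrite expr_div_n mulrCA ler_peMr ?exprn_ge0//.
  rewrite ler_pdivlMr ?exprn_gt0// mul1r ler_weXn2l//; last by rewrite -ltnS.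
  by rewrite lerDl ltW.
rewrite ler_wpM2l ?exprn_ge0 ?(ltW e1)//.
rewrite -zonotope_polyE//; last exact: regular_rvol.
apply: le_rvol; [exact: (proj1 (cc _))|exact: (proj1 (ccb _))|].
apply: minkowskiS => //; rewrite zonotope_scaledE.
apply: subset_trans (scale_setS ZB) _.
by rewrite scale_cballM ?(ltW e1)// divfK// gt_eqF.
Qed.

Lemma cvg_sum_ord n (f : 'I_n -> nat -> R) (l : 'I_n -> R) :
  (forall i, f i k @[k --> \oo] --> l i) ->
  (\sum_(i < n) f i k) @[k --> \oo] --> \sum_(i < n) l i.
Proof.
move=> H; apply: (cvg_big (op := +%R)) => // x.
exact: add_continuous.
Qed.

Lemma zonotope_poly_cvg (us : nat -> seq 'rV[R]_m) K (t : R) : ball_zonotopes us ->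
  compact_convex K -> 0 <= t ->
  (zonotope_poly (us k) rvol K).[t] @[k --> \oo] --> rvol (minkowski K (cball 0 t)).
Proof.
move=> Hus cK t0; set g := rvol _.
apply: (@squeeze_cvgr _ _ _ _ (fun=> g) (fun k => (1 + k.+1%:R^-1) ^+ m * g)).
- by apply: nearW => k; have [? ?] := Hus k; apply: zonotope_poly_ball => //; rewrite invr_gt0.
- exact: cvg_cst.
suff : (1 + k.+1%:R^-1) ^+ m * g @[k --> \oo] --> (1 : R) ^+ m * g by rewrite expr1n mul1r.
apply: cvgM; last exact: cvg_cst.
have : (1 + k.+1%:R^-1 : R) @[k --> \oo] --> (1 : R).
  suff : (1 + k.+1%:R^-1 : R) @[k --> \oo] --> (1 + 0 : R) by rewrite addr0.
  apply: cvgD; first exact: cvg_cst.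
  exact: cvg_harmonic.
move=> H; elim: (m) => [|i IH].
  by under eq_fun do rewrite expr0; rewrite expr0; exact: cvg_cst.
by under eq_fun do rewrite exprS; rewrite exprS; apply: cvgM.
Qed.

Lemma zonotope_poly_coef_cvg (us : nat -> seq 'rV[R]_m) K i :
  ball_zonotopes us -> compact_convex K ->
  (zonotope_poly (us k) rvol K)`_i @[k --> \oo] --> (ball_poly K)`_i.
Proof.
move=> Hus cK; rewrite /ball_poly coef_sum.
under eq_bigr do rewrite coefZ.
rewrite (_ : (fun k => _) = (fun k => \sum_(j < m.+1)
    (zonotope_poly (us k) rvol K).[j%:R] * (nat_lagrange j)`_i)); last first.
  apply/funext => k.
  rewrite {1}(poly_lagrange (size_zonotope_poly (us k) cK)) coef_sum.
  by apply: eq_bigr => j _; rewrite coefZ.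
apply: cvg_sum_ord => j; apply: cvgM; last exact: cvg_cst.
exact: zonotope_poly_cvg.
Qed.

Lemma size_ball_poly K : (size (ball_poly K) <= m.+1)%N.
Proof.
have x_inj : injective (fun k : nat => k%:R : R) by move=> i j /eqP; rewrite eqr_nat => /eqP.
apply: leq_trans (size_sum _ _ _) _; apply/bigmax_leqP => j _; apply:
  leq_trans (size_scale_leq _ _) _.
by rewrite size_lagrange_.
Qed.

Lemma ball_poly_coef_le (us : nat -> seq 'rV[R]_m) K L i : ball_zonotopes us -> compact_convex K ->
  compact_convex L -> K `<=` L -> (ball_poly K)`_i <= (ball_poly L)`_i.
Proof.
move=> Hus cK cL KL.
have H1 := @zonotope_poly_coef_cvg us K i Hus cK.
have H2 := @zonotope_poly_coef_cvg us L i Hus cL.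
apply: (ler_cvg_to H1 H2).
apply: nearW => k; apply: zonotope_poly_coef_le => //; exact: regular_rvol.
Qed.

(** Both sides are limits of the zonotope polynomials evaluated at [t], the left by squeezing and
    the right by convergence of coefficients. So the interpolation is exact at every [t >= 0], not
    only at its nodes. *)
Lemma ball_polyE (us : nat -> seq 'rV[R]_m) K (t : R) :
  ball_zonotopes us -> compact_convex K -> 0 <= t ->
  rvol (minkowski K (cball 0 t)) = (ball_poly K).[t].
Proof.
move=> Hus cK t0; apply: (@cvg_unique _ _ (fmap (fun k => (zonotope_poly (us k) rvol K).[t]) \oo)).
- exact: norm_hausdorff.
- exact: zonotope_poly_cvg.
rewrite (horner_coef_wide _ (size_ball_poly K)).
rewrite (_ : (fun k => _) = (fun k => \sum_(i < m.+1)
    (zonotope_poly (us k) rvol K)`_i * t ^+ i)); last first.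
  by apply/funext => k; rewrite (horner_coef_wide _ (size_zonotope_poly _ cK)).
apply: cvg_sum_ord => i; apply: cvgM; last exact: cvg_cst.
exact: zonotope_poly_coef_cvg.
Qed.

End Steiner.

(** * The ball as a limit of zonotopes *)

Section Separation.
Variable R : realType.

(** The vector [v] points to [y] from its nearest point [p] in [C]: a point of [C] strictly beyond
    the hyperplane through [p] would allow a move from [p] that comes closer to [y]. *)
Lemma separation m (C : set 'rV[R]_m) (y : 'rV[R]_m) :
  compact C -> convex_set C -> ~ C y ->
  exists v, forall x, C x -> dot x v < dot y v.
Proof.
move=> cC vC Cy; have [->|/set0P C0] := eqVneq C set0; first by exists 0.
have [p /set_mem Cp Hp] := compact_EVT_min C0 cC
  (continuous_subspaceT (@euclid_dist_continuous R m y)).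
exists (y - p) => x Cx.
have v0 : 0 < dot (y - p) (y - p).
  rewrite -sqr_enorm exprn_gt0// enorm_gt0 subr_eq0.
  by apply/eqP => e; apply: Cy; rewrite e.
suff : dot (x - p) (y - p) <= 0 by move: v0; rewrite !dotE; lra.
rewrite leNgt; apply/negP => d0.
set d := dot _ _ in d0; set N := dot (x - p) (x - p).
have N0 : 0 < N.
  rewrite /N -sqr_enorm exprn_gt0// enorm_gt0; apply: contraTneq d0 => e.
  by rewrite /d e dot0l ltxx.
(* The value [d / N] minimises the distance to [y] along the line from [p] to [x]; the cap keeps the
   point on the segment. *)
pose t := Num.min 1 (d / N).
have t0 : 0 < t by rewrite /t lt_min ltr01 divr_gt0.
have t01 : 0 <= t <= 1 by rewrite (ltW t0) /t ge_min lexx.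
have tN : t * N <= d by rewrite -ler_pdivlMr// /t ge_min lexx orbT.
have := Hp _ (mem_set (vC _ _ Cx Cp t t01)); rewrite /edist.
rewrite -(@ler_pXn2r _ 2) ?nnegrE ?enorm_ge0// !sqr_enorm.
have -> : t *: x + (1 - t) *: p - y = (p - y) + t *: (x - p).
  by apply/rowP => i; rewrite !rVE; ring.
rewrite -(opprB y p) [dot (- (y - p) + _) _]dotDl !dotDr !dotZl !dotZr !dotNl !dotNr.
by rewrite (dotC (y - p) (x - p)) -/d -/N; nra.
Qed.

End Separation.

Section Zonoid.
Variable R : realType.
Variable m : nat.
Implicit Types (us : seq 'rV[R]_m) (u v : 'rV[R]_m).

(** The support function of [zonotope us]. The total length [zlen] below is a Lipschitz constant for
    it and is preserved by averaging over a nonempty list, so it serves as the normalisation. *)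
Definition zsupp us v : R := \sum_(u <- us) `|dot u v|.
Definition zlen us : R := \sum_(u <- us) enorm u.

Lemma zsuppZ us (a : R) v : zsupp us (a *: v) = `|a| * zsupp us v.
Proof. by rewrite mulr_sumr; apply: eq_bigr => u _; rewrite dotZr normrM. Qed.

Lemma zsupp_scaled us (a : R) v : zsupp (scaled a us) v = `|a| * zsupp us v.
Proof. by rewrite /zsupp big_map mulr_sumr; apply: eq_bigr => u _; rewrite dotZl normrM. Qed.

Lemma zonotope_support us v : exists2 z, zonotope us z & dot z v = zsupp us v.
Proof.
elim: us => [|u us [z Zz e]] /=; first by exists 0 => //; rewrite dot0l /zsupp big_nil.
exists (Num.sg (dot u v) *: u + z).
  exists (Num.sg (dot u v) *: u), z; split => //; exists (Num.sg (dot u v)); split => //.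
  by rewrite normr_sg; case: (_ != 0).
by rewrite dotDl dotZl e /zsupp big_cons -normrEsg.
Qed.

Lemma dot_zonotope_le us v z : zonotope us z -> dot z v <= zsupp us v.
Proof.
elim: us z => [|u us IH] z /=; first by move=> ->; rewrite dot0l /zsupp big_nil.
move=> [_ [z' [[s [s1 ->]] /IH Hz ->]]]; rewrite dotDl dotZl /zsupp big_cons lerD//.
by apply: le_trans (ler_norm _) _; rewrite normrM ler_piMl.
Qed.

Lemma cball_sub_zonotope us : (forall v, enorm v <= zsupp us v) ->
  cball 0 1 `<=` zonotope us.
Proof.
move=> H y; rewrite /cball /edist /= subr0 => y1; apply: contrapT => nZ.
have [cZ vZ] := zonotope_cc us.
have [v Hv] := separation cZ vZ nZ.
have [z Zz e] := zonotope_support us v.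
have := Hv z Zz; rewrite e; have := H v; have := dot_le_enorm y v.
have := enorm_ge0 v; nra.
Qed.

Lemma zonotope_sub_cball us (M : R) : 0 <= M -> (forall v, zsupp us v <= M * enorm v) ->
  zonotope us `<=` cball 0 M.
Proof.
move=> M0 H z Zz; rewrite /cball /edist /= subr0.
have := dot_zonotope_le z Zz; rewrite -sqr_enorm => /le_trans /(_ (H z)).
have := enorm_ge0 z; rewrite le_eqVlt => /orP[/eqP <- //|z0].
by rewrite expr2 ler_pM2r.
Qed.

Lemma zsupp_lip us v w : zsupp us v <= zsupp us w + zlen us * enorm (v - w).
Proof.
rewrite /zsupp /zlen mulr_suml -big_split; apply: ler_sum => u _ /=.
have -> : dot u v = dot u w + dot u (v - w) by rewrite !dotE; ring.
by apply: le_trans (ler_normD _ _) _; rewrite lerD2l normr_dot_le.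
Qed.

Lemma sphere_net (d : R) : 0 < d -> exists ys : seq 'rV[R]_m,
  (forall y, y \in ys -> enorm y = 1) /\
  forall v, enorm v = 1 -> exists2 y, y \in ys & enorm (v - y) < d.
Proof.
move=> d0; pose S := [set v : 'rV[R]_m | enorm v = 1].
have cS : compact S.
  apply: (@cube_compact _ _ _ 1).
    apply: (@closed_comp _ _ (@enorm R m) [set y | y = 1]); last exact: closed_eq.
    by move=> x _; exact: enorm_continuous.
  by move=> v Sv i; apply: le_trans (coord_le_enorm v i) _; rewrite Sv.
rewrite compact_cover in cS.
have [|v Sv|D DS SD] := cS _ S (fun y => [set v | enorm (v - y) < d]).
- move=> y _; apply: (@open_comp _ _ (fun v => edist v y) [set r | r < d]); last exact: open_lt.
  by move=> v _; exact: euclid_dist_continuous.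
- by exists v => //=; rewrite subrr enorm0.
exists (finmap.enum_fset D); split => [y /DS|v /SD[y /= yD yv]]; first by rewrite inE.
by exists y.
Qed.

(** The support function of this family at [v] is the mean of the values at the reflected vectors.
    When [y] and [v0] have equal length, the reflection for [y] moves [y] to [v0]. *)
Definition average (f : seq ('rV[R]_m)) (v0 : 'rV[R]_m) us :=
  flatten [seq [seq (size f)%:R^-1 *: refl (y - v0) u | u <- us] | y <- f].

Lemma zsupp_average f v0 us v : zsupp (average f v0 us) v =
  (size f)%:R^-1 * \sum_(y <- f) zsupp us (refl (y - v0) v).
Proof.
rewrite /zsupp /average big_flatten /= big_map mulr_sumr; apply: eq_bigr => y _.
rewrite big_map mulr_sumr; apply: eq_bigr => u _.
by rewrite dotZl normrM ger0_norm// refl_dotC.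
Qed.

Lemma zlen_average f v0 us : (0 < size f)%N -> zlen (average f v0 us) = zlen us.
Proof.
move=> f0; rewrite /zlen /average big_flatten /= big_map.
rewrite (eq_bigr (fun=> (size f)%:R^-1 * zlen us)); last first.
  move=> y _; rewrite big_map mulr_sumr; apply: eq_bigr => u _.
  by rewrite enormZ enorm_refl ger0_norm.
rewrite big_const_seq count_predT iter_addr_0 -[LHS]mulr_natl mulrA divff ?mul1r//.
by rewrite pnatr_eq0 -lt0n.
Qed.

Lemma zsupp_le_zlen us v : zsupp us v <= zlen us * enorm v.
Proof. by rewrite /zsupp /zlen mulr_suml; apply: ler_sum => u _; exact: normr_dot_le. Qed.

Lemma zsupp_ge0 us v : 0 <= zsupp us v.
Proof. by apply: sumr_ge0. Qed.

(** Arbitrary bounds [a], [b] replace the minimum and maximum, so neither has to be attained.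
    Without the condition on [zlen], small values would be reached by mere scaling. *)
Definition oscillation : set R := [set w | exists us a b, [/\ zlen us = 1,
  (forall v, enorm v = 1 -> a <= zsupp us v <= b) & w = b - a]].

(* Averaging over the reflections taking a finite net of the sphere to a near-minimum
   [v0] of the support function lowers its maximum by a fixed amount. *)
Lemma inf_oscillation (e1 : 'rV[R]_m) : enorm e1 = 1 -> inf oscillation = 0.
Proof.
move=> e1u.
have O0 w : oscillation w -> 0 <= w.
  by move=> [us [a [b [_ H ->]]]]; rewrite subr_ge0; have /andP[/le_trans] := H _ e1u; apply.
have hl : has_lbound oscillation by exists 0 => w; exact: O0.
have hi : has_inf oscillation.
  split => //; exists 1; exists [:: e1], 0, 1; split; last by rewrite subr0.
    by rewrite /zlen big_seq1.
  move=> v v1; rewrite zsupp_ge0; apply: le_trans (zsupp_le_zlen _ _) _.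
  by rewrite v1 /zlen big_seq1 e1u mulr1.
apply/eqP; rewrite eq_le; apply/andP; split; last by apply: lb_le_inf => //; case: hi.
rewrite leNgt; apply/negP => w0; set w := inf oscillation in w0.
have w40 : 0 < w / 4 by rewrite divr_gt0.
have [ys [ys1 Hys]] := sphere_net w40.
have N0 : (0 < size ys)%N by have [y + _] := Hys _ e1u; case: (ys).
pose N : R := (size ys)%:R.
have Np : 1 <= N by rewrite ler1n.
have eps0 : 0 < w / 4 / N by rewrite divr_gt0// (lt_le_trans ltr01).
have [_ [us [a [b [len1 H ->]]]] Hab] := inf_adherent eps0 hi.
rewrite -/w in Hab.
have epsw : w / 4 / N <= w / 4 by rewrite ler_pdivrMr ?(lt_le_trans ltr01)// ler_peMr// ltW.
have wle us' a' b' : zlen us' = 1 -> (forall v, enorm v = 1 -> a' <= zsupp us' v <= b') ->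
    w <= b' - a'.
  by move=> l' H'; apply: ge_inf => //; exists us', a', b'.
have wab := wle _ _ _ len1 H.
(* If the support function were never this low, [a + w / 4] would be a lower bound and the
   oscillation would drop below its infimum. *)
have [[v0 [v01 hv0]]|nv0] := pselect (exists v0, enorm v0 = 1 /\ zsupp us v0 < a + w / 4);
  last first.
  suff : w <= b - (a + w / 4) by lra.
  apply: (wle us) => // v v1; have /andP[_ ->] := H _ v1; rewrite andbT leNgt.
  by apply/negP => lt; apply: nv0; exists v.
(* For each [v] some net point [y] is within [w / 4]; its reflection brings [v] that close to [v0],
   so this summand is at most [a + w / 2]. The other [N - 1] are at most [b]. *)
pose b' := N^-1 * (a + w / 2 + (N - 1) * b).
have : w <= b' - a.
  apply: (wle (average ys v0 us)); first by rewrite zlen_average.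
  move=> v v1; rewrite zsupp_average; apply/andP; split.
    rewrite -(@ler_pM2l _ N) ?(lt_le_trans ltr01)// mulrA divff ?mul1r; last first.
      by rewrite gt_eqF// (lt_le_trans ltr01).
    have -> : N * a = \sum_(y <- ys) a.
      by rewrite big_const_seq count_predT iter_addr_0 mulr_natl.
    apply: ler_sum => y _.
    by have /andP[] := H (refl (y - v0) v) (etrans (enorm_refl _ _) v1).
  rewrite ler_pM2l ?invr_gt0 ?(lt_le_trans ltr01)//.
  have [y yys yv] := Hys v v1.
  rewrite (perm_big _ (perm_to_rem yys)) big_cons lerD//.
    have ry : refl (y - v0) y = v0 by apply: refl_swap; rewrite ys1// v01.
    apply: le_trans (zsupp_lip us _ v0) _.
    have -> : enorm (refl (y - v0) v - v0) = enorm (v - y).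
      by rewrite -(enorm_refl (y - v0) (v - y)) reflB ry.
    by rewrite len1 mul1r; lra.
  have -> : (N - 1) * b = \sum_(z <- rem y ys) b.
    rewrite big_const_seq count_predT iter_addr_0 size_rem// -mulr_natl.
    by rewrite -subn1 natrB.
  apply: ler_sum => z _.
  by have /andP[] := H (refl (z - v0) v) (etrans (enorm_refl _ _) v1).
apply/negP; rewrite -ltNge.
have Nn0 : N != 0 by rewrite gt_eqF// (lt_le_trans ltr01).
(* The gain of the average is at least [w / 2 / N], twice the slack [w / 4 / N] with which the
   infimum was approached. *)
have -> : b' - a = (b - a) - (b - a - w / 2) / N by rewrite /b'; field.
have h1 : w / 2 / N <= (b - a - w / 2) / N.
  by rewrite ler_pM2r ?invr_gt0 ?(lt_le_trans ltr01)//; lra.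
have h2 : w / 2 / N = w / 4 / N + w / 4 / N by field.
lra.
Qed.

End Zonoid.

Section BallZonoid.
Variable R : realType.

Lemma dot_delta m (u : 'rV[R]_m) i : dot u (delta_mx 0 i) = u 0 i.
Proof.
rewrite /dot (bigD1 i)//= mxE !eqxx mulr1 big1 ?addr0// => j ji.
by rewrite mxE (negbTE ji) andbF mulr0.
Qed.

Lemma enorm_delta m (i : 'I_m) : enorm (delta_mx 0 i : 'rV[R]_m) = 1.
Proof. by rewrite enormE dot_delta mxE !eqxx sqrtr1. Qed.

(** A small oscillation helps only relative to the size of the support function. Its sum over the
    coordinate vectors dominates [zlen], which is [1], so [b] is at least [1 / M]; dividing by [a]
    then turns the additive gap into a ratio. *)
Lemma ball_is_zonoid m (e : R) : 0 < e -> exists us : seq 'rV[R]_m.+1,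
  cball 0 1 `<=` zonotope us /\ zonotope us `<=` cball 0 (1 + e).
Proof.
move=> e0; have O := inf_oscillation (enorm_delta (0 : 'I_m.+1)).
pose M : R := m.+1%:R; have M0 : 0 < M by rewrite ltr0n.
(* From [b >= 1 / M] and a gap below this value one gets [a > 1 / (M * (1 + e))]; the gap is then at
   most [e * a], so [b <= (1 + e) * a]. *)
have eta0 : 0 < e / (M * (1 + e)) by rewrite divr_gt0// mulr_gt0// addr_gt0.
have hi : has_inf (@oscillation R m.+1).
  split.
    exists 1; exists [:: delta_mx 0 0], 0, 1; split; last by rewrite subr0.
      by rewrite /zlen big_seq1 enorm_delta.
    move=> v v1; rewrite zsupp_ge0; apply: le_trans (zsupp_le_zlen _ _) _.
    by rewrite v1 /zlen big_seq1 enorm_delta mulr1.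
  exists 0 => w [us [a [b [_ H ->]]]]; rewrite subr_ge0.
  by have /andP[/le_trans] := H _ (enorm_delta 0); apply.
have [_ [us [a [b [len1 H ->]]]]] := inf_adherent eta0 hi.
rewrite O add0r => Hab.
have bM : 1 <= M * b.
  have -> : M * b = \sum_(i < m.+1) b by rewrite sumr_const card_ord mulr_natl.
  apply: (@le_trans _ _ (\sum_(i < m.+1) zsupp us (delta_mx 0 i))); last first.
    by apply: ler_sum => i _; have /andP[] := H _ (enorm_delta i).
  rewrite -len1 /zlen /zsupp exchange_big /=; apply: ler_sum => u _.
  by under eq_bigr do rewrite dot_delta; exact: enorm_le_sum.
have e1 : 0 < 1 + e by rewrite addr_gt0.
have eM : e / (M * (1 + e)) * (M * (1 + e)) = e by rewrite divfK// gt_eqF// mulr_gt0.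
set eta := e / _ in eta0 Hab eM.
have P0 : 0 < M * (1 + e) by rewrite mulr_gt0.
have bP : 1 + e <= b * (M * (1 + e)) by rewrite mulrCA mulrA ler_peMl ?(ltW e1).
have aM : 1 < a * (M * (1 + e)).
  have : (b - eta) * (M * (1 + e)) < a * (M * (1 + e)) by rewrite ltr_pM2r//; lra.
  by apply: le_lt_trans; rewrite mulrBl eM; lra.
have a0 : 0 < a by rewrite -(pmulr_lgt0 _ P0) (lt_trans ltr01).
have eta_le : eta <= e * a by rewrite -(ler_pM2r P0) eM -mulrA ler_peMr ?ltW.
have bae : b <= (1 + e) * a by lra.
exists (scaled a^-1 us).
have hom v : a * enorm v <= zsupp us v <= b * enorm v.
  have [->|v0] := eqVneq v 0.
    by rewrite -(scale0r 0) zsuppZ enormZ normr0 !mul0r !mulr0 lexx.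
  have ev : 0 < enorm v by rewrite enorm_gt0.
  have := H ((enorm v)^-1 *: v).
  rewrite enormZ normfV gtr0_norm// mulVf ?gt_eqF// => /(_ erefl).
  by rewrite zsuppZ normfV gtr0_norm// ler_pdivlMl// ler_pdivrMl// ![enorm v * _]mulrC.
split.
  apply: cball_sub_zonotope => v; rewrite zsupp_scaled normfV gtr0_norm//.
  by rewrite ler_pdivlMl//; have /andP[] := hom v.
apply: zonotope_sub_cball; first exact: ltW.
move=> v; rewrite zsupp_scaled normfV gtr0_norm// ler_pdivrMl//.
have /andP[_ /le_trans] := hom v; apply; rewrite mulrA ler_wpM2r ?enorm_ge0//.
by rewrite mulrC.
Qed.

Lemma ball_zonotopes_exist m : exists us : nat -> seq 'rV[R]_m.+1, ball_zonotopes us.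
Proof.
have H (k : nat) : exists us : seq 'rV[R]_m.+1,
  cball 0 1 `<=` zonotope us /\ zonotope us `<=` cball 0 (1 + k.+1%:R^-1).
  by apply: ball_is_zonoid; rewrite invr_gt0.
by have [us Hus] := choice H; exists us.
Qed.

End BallZonoid.

(** * Rolling balls: from local to global *)

Section Rolling.
Variable R : realType.

(* Otherwise [phi s - s * phi 1] has a positive maximum on [0, 1]; its affine minorant at the
   first maximum point is constant, so the maximum is also attained further left. *)
Lemma locally_supported_ge0 (phi : R -> R) : continuous phi -> phi 0 = 0 ->
  (exists2 d : R, 0 < d & forall s, `|s| < d -> 0 <= phi s) ->
  (forall s0, 0 <= s0 <= 1 -> exists a d : R, 0 < d /\
     forall s, `|s - s0| < d -> phi s0 + a * (s - s0) <= phi s) ->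
  0 <= phi 1.
Proof.
move=> cphi phi0 [d0 d00 Hd0] Hloc; rewrite leNgt; apply/negP => phi1.
pose chi s := phi s - s * phi 1.
have cchi : continuous chi.
  move=> s; apply: cvgB; first exact: cphi.
  by apply: cvgM; [exact: cvg_id|exact: cvg_cst].
have I0 : `[(0 : R), 1]%classic !=set0 by exists 0; rewrite /= in_itv /= lexx ler01.
have [x1 /set_mem /= x1I Hx1] :=
  compact_EVT_max I0 (@segment_compact R 0 1) (continuous_subspaceT cchi).
set M := chi x1.
have chiM s : 0 <= s <= 1 -> chi s <= M by move=> s01; apply: Hx1; rewrite inE /= in_itv.
(* Near [0] the function [phi] is nonnegative, whereas [- s * phi 1] is positive. *)
have M0 : 0 < M.
  pose s := Num.min 1 (d0 / 2).
  have s0 : 0 < s by rewrite lt_min ltr01 divr_gt0.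
  have s1 : s <= 1 by rewrite ge_min lexx.
  have sd : s < d0.
    by apply: (@le_lt_trans _ _ (d0 / 2)); [rewrite ge_min lexx orbT|lra].
  have := chiM s; rewrite (ltW s0) s1 => /(_ isT); apply: lt_le_trans.
  have := Hd0 s; rewrite gtr0_norm// => /(_ sd); rewrite /chi; nra.
pose A := `[0, 1]%classic `&` [set s | chi s = M].
have cA : compact A.
  apply: compact_closedI; last first.
    by apply: (@closed_comp _ _ chi [set y | y = M]); [move=> s _; exact: cchi|exact: closed_eq].
  exact: segment_compact.
have A0 : A !=set0 by exists x1.
have cid : continuous (fun x : R => x) by move=> x; exact: cvg_id.
have [x0 /set_mem [x0I x0M] Hx0] := compact_EVT_min A0 cA (continuous_subspaceT cid).
rewrite /= in_itv /= in x0M x0I; case/andP: x0I => x00 x01.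
have x0n0 : x0 != 0.
  by apply/eqP => e; move: M0; rewrite -x0M e /chi phi0 mul0r subr0 ltxx.
have x0n1 : x0 != 1.
  by apply/eqP => e; move: M0; rewrite -x0M e /chi mul1r subrr ltxx.
have x0p : 0 < x0 by rewrite lt_neqAle eq_sym x0n0.
have x0l : x0 < 1 by rewrite lt_neqAle x0n1.
have [|a [d [dp Hd]]] := Hloc x0; first by rewrite x00.
pose e := Num.min (d / 2) (Num.min (x0 / 2) ((1 - x0) / 2)).
have ep : 0 < e by rewrite !lt_min !divr_gt0// subr_gt0.
have ed : e <= d / 2 by rewrite ge_min lexx.
have ex : e <= x0 / 2 by rewrite !ge_min lexx orbT.
have ex' : e <= (1 - x0) / 2 by rewrite !ge_min lexx !orbT.
have H1 := chiM (x0 + e); have H2 := chiM (x0 - e).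
have {}H1 : chi (x0 + e) <= M by apply: H1; apply/andP; split; lra.
have {}H2 : chi (x0 - e) <= M by apply: H2; apply/andP; split; lra.
have K1 := Hd (x0 + e); have K2 := Hd (x0 - e).
have {}K1 : phi x0 + a * e <= phi (x0 + e).
  by move: K1; rewrite addrAC subrr add0r gtr0_norm//; apply; lra.
have {}K2 : phi x0 - a * e <= phi (x0 - e).
  by move: K2; rewrite addrAC subrr add0r normrN gtr0_norm// mulrN; apply; lra.
(* The affine minorant gives [chi (x0 - e) + chi (x0 + e) >= 2 * M], and neither term exceeds
   [M]. *)
have chiE : chi (x0 - e) = M.
  apply/eqP; rewrite eq_le H2 /=; move: H1 H2 K1 K2; rewrite -x0M /chi; nra.
have : x0 <= x0 - e.
  apply: Hx0; rewrite inE; split => //.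
  by rewrite /= in_itv /=; apply/andP; split; lra.
lra.
Qed.

Lemma unit_lipschitz m (u v : 'rV[R]_m) : u != 0 -> v != 0 ->
  enorm ((enorm v)^-1 *: v - (enorm u)^-1 *: u) <= 2 * enorm (v - u) / enorm u.
Proof.
move=> u0 v0; have eu : 0 < enorm u by rewrite enorm_gt0.
have ev : 0 < enorm v by rewrite enorm_gt0.
have -> : (enorm v)^-1 *: v - (enorm u)^-1 *: u =
    (enorm u)^-1 *: ((v - u) + ((enorm u - enorm v) / enorm v) *: v).
  by apply/rowP => i; rewrite !rVE; field; rewrite !gt_eqF.
rewrite enormZ normfV gtr0_norm// mulrC ler_wpM2r ?invr_ge0 ?(ltW eu)//.
apply: le_trans (enormD _ _) _; rewrite enormZ normrM normfV (gtr0_norm ev) divfK ?gt_eqF//.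
suff : `|enorm u - enorm v| <= enorm (v - u) by lra.
by rewrite ler_norml; have := enormDB u v; have := enormDB v u; rewrite (enormB u v) => *;
  apply/andP; split; lra.
Qed.

Definition maximizer m (K : set 'rV[R]_m) (u p : 'rV[R]_m) :=
  K p /\ forall x, K x -> dot x u <= dot p u.

Lemma maximizer_exists m (K : set 'rV[R]_m) u : compact K -> K !=set0 ->
  exists p, maximizer K u p.
Proof.
move=> cK K0.
have [p /set_mem Kp Hp] := compact_EVT_max K0 cK (continuous_subspaceT (@dot_continuous R m u)).
by exists p; split => // x Kx; apply: Hp; rewrite inE.
Qed.

(** The local condition of [lambda_concave], separated from the requirement of being a body, with
    [r] for [lam^-1]. *)
Definition locally_ball m (r : R) (K : set 'rV[R]_m) := forall p, boundary K p ->
    exists c, edist p c = r /\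
      exists U : set 'rV[R]_m, [/\ open U, U p & cball c r `&` U `<=` K `&` U].

Lemma maximizer_boundary m (K : set 'rV[R]_m) u p : u != 0 -> maximizer K u p ->
  boundary K p.
Proof.
move=> u0 [Kp Hp]; split; first exact: subset_closure.
rewrite /interior => /nbhs_enormP[e e0 He].
have eu : 0 < enorm u by rewrite enorm_gt0.
have /Hp : K (p + (e / 2 / enorm u) *: u).
  apply: He; rewrite addrAC subrr add0r enormZ ger0_norm ?divr_ge0 ?(ltW e0) ?(ltW eu)//.
  by rewrite divfK ?gt_eqF//; lra.
rewrite dotDl dotZl leNgt ltrDl mulr_gt0 ?divr_gt0//.
by rewrite -sqr_enorm exprn_gt0.
Qed.

(** The centre is forced: a direction entering the ball at [p] cannot increase the product with [u],
    so [c - p] is opposite to [u]. This replaces the unknown centre by an explicit one. *)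
Lemma maximizer_center m (K : set 'rV[R]_m) (r : R) u p : 0 < r -> u != 0 ->
  locally_ball r K -> maximizer K u p ->
  exists2 e : R, 0 < e & forall y, cball (p - (r / enorm u) *: u) r y -> enorm (y - p) < e -> K y.
Proof.
move=> r0 u0 loc mp; have [c [pc [U [oU Up HU]]]] := loc p (maximizer_boundary u0 mp).
have eu : 0 < enorm u by rewrite enorm_gt0.
have /nbhs_enormP[e e0 He] : nbhs p U by exact: open_nbhs_nbhs.
have [Kp Hp] := mp.
have [w wE] : exists w, w = c - p by exists (c - p).
have wr : dot w w = r ^+ 2 by rewrite -sqr_enorm wE enormB -/(edist p c) pc.
have Hz z : 0 < dot z w -> dot z u <= 0.
  move=> zw; have z0 : z != 0 by apply: contraTneq zw => ->; rewrite dot0l ltxx.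
  have ez : 0 < enorm z by rewrite enorm_gt0.
  have zz : 0 < dot z z by rewrite -sqr_enorm exprn_gt0.
  (* The first bound keeps [p + t *: z] in the neighborhood, the second keeps it in the ball. *)
  pose t := Num.min (e / 2 / enorm z) (2 * dot z w / dot z z).
  have t0 : 0 < t by rewrite lt_min !divr_gt0// mulr_gt0.
  have tz : t * dot z z <= 2 * dot z w by rewrite -ler_pdivlMr// ge_min lexx orbT.
  have te : t * enorm z <= e / 2 by rewrite -ler_pdivlMr// ge_min lexx.
  have Ky : K (p + t *: z).
    suff [] : (K `&` U) (p + t *: z) by [].
    apply: HU; split; last first.
      by apply: He; rewrite addrAC subrr add0r enormZ gtr0_norm//; lra.
    rewrite /cball /edist /= -(@ler_pXn2r _ 2) ?nnegrE ?enorm_ge0 ?(ltW r0)// sqr_enorm.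
    have -> : p + t *: z - c = t *: z - w by apply/rowP => i; rewrite wE !rVE; ring.
    by rewrite !dotE (dotC w z) wr; nra.
  have := Hp _ Ky; rewrite dotDl dotZl gerDl pmulr_rle0//.
have uw : dot u w = - (r * enorm u).
  have ge : 0 <= dot u w + r * enorm u.
    have := normr_dot_le u w; have -> : enorm w = r by rewrite wE enormB -/(edist p c).
    by rewrite ler_norml => /andP[]; lra.
  have [e0'|n0] := eqVneq (dot u w + r * enorm u) 0; first by lra.
  have gt : 0 < dot u w + r * enorm u by rewrite lt_neqAle eq_sym n0.
  (* Unless [w] is opposite to [u], this bisecting direction has positive product with both vectors,
     against [Hz]. *)
  have := Hz (enorm u *: w + r *: u); rewrite !dotE (dotC w u) wr -(sqr_enorm u).
  have h1 : 0 < enorm u * r ^+ 2 + r * dot u w by nra.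
  have h2 : 0 < enorm u * dot u w + r * enorm u ^+ 2 by nra.
  by move=> /(_ h1); lra.
have cE : c = p - (r / enorm u) *: u.
  apply/eqP; rewrite -subr_eq0 -enorm_eq0 -sqrf_eq0 sqr_enorm.
  have -> : c - (p - (r / enorm u) *: u) = w + (r / enorm u) *: u.
    by apply/rowP => i; rewrite wE !rVE; ring.
  rewrite !dotE (dotC w u) wr uw -(sqr_enorm u); apply/eqP; field.
  by rewrite gt_eqF.
exists e => // y yc yp; suff [] : (K `&` U) y by [].
by apply: HU; split; [rewrite cE|exact: He].
Qed.

End Rolling.

Section RollingBall.
Variable R : realType.

Lemma lipschitz_continuous (f : R -> R) (C : R) :
  (forall s t, f s <= f t + C * `|s - t|) -> continuous f.
Proof.
move=> H x; apply/cvgrPdist_lt => e e0.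
have C0 : 0 < `|C| + 1 by rewrite ltr_pwDr.
near=> y.
have yx : `|x - y| < e / (`|C| + 1).
  by near: y; apply/nbhs_ballP; exists (e / (`|C| + 1)) => //=; rewrite divr_gt0.
have {}yx : (`|C| + 1) * `|x - y| < e by rewrite mulrC -ltr_pdivlMr.
have CC : C * `|x - y| <= `|C| * `|x - y| by rewrite ler_wpM2r// ler_norm.
have nn : 0 <= `|x - y| by [].
rewrite ltr_norml; have := H x y; have := H y x; rewrite (distrC y x) => *.
by apply/andP; split; lra.
Unshelve. all: by end_near. Qed.

(* In terms of the support function [h] of [K]: the linear form [dot c] supports
   [h - r * enorm] from below at [u], locally. *)
Lemma maximizer_local_support m (K : set 'rV[R]_m) (r : R) u p : 0 < r -> u != 0 ->
  locally_ball r K -> maximizer K u p ->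
  let c := p - (r / enorm u) *: u in
  dot p u = dot c u + r * enorm u /\
  exists2 d : R, 0 < d & forall v, enorm (v - u) < d ->
    exists2 x, K x & dot c v + r * enorm v <= dot x v.
Proof.
move=> r0 u0 loc mp c; have eu : 0 < enorm u by rewrite enorm_gt0.
split.
  rewrite /c !dotE -(sqr_enorm u); field.
  by rewrite gt_eqF.
have [e e0 He] := maximizer_center r0 u0 loc mp.
(* The first bound excludes [v = 0]; the second is what [unit_lipschitz] requires to keep the
   extremal point of the ball in direction [v] within [e] of [p]. *)
exists (Num.min (enorm u) (e * enorm u / (2 * r))).
  by rewrite lt_min eu divr_gt0 ?mulr_gt0.
move=> v; rewrite lt_min => /andP[vu1 vu2].
have v0 : v != 0.
  by apply: contraTneq vu1 => ->; rewrite sub0r enormN ltxx.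
have ev : 0 < enorm v by rewrite enorm_gt0.
exists (c + (r / enorm v) *: v); last first.
  rewrite [dot (c + _) v]dotDl dotZl -(sqr_enorm v) lerD2l.
  by rewrite expr2 mulrA divfK// gt_eqF.
apply: He.
  by rewrite /cball /edist /= addrAC subrr add0r enormZ normrM normfV !gtr0_norm// divfK// gt_eqF.
have -> : c + (r / enorm v) *: v - p = r *: ((enorm v)^-1 *: v - (enorm u)^-1 *: u).
  by apply/rowP => i; rewrite /c !rVE; ring.
rewrite enormZ gtr0_norm//; apply: le_lt_trans (ler_wpM2l (ltW r0) (unit_lipschitz u0 v0)) _.
by rewrite mulrA ltr_pdivrMr// mulrCA mulrA -ltr_pdivlMl ?mulr_gt0// mulrC.
Qed.

(* [h - r * enorm] has a local linear minorant at every nonzero point, so along segments that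
   avoid [0] the local minorant [dot c] at [u] is global.  Directions opposite to [u] are
   reached by perturbation, which needs dimension at least two. *)
Lemma rolling_ball m (K : set 'rV[R]_m.+2) (r : R) u p : 0 < r -> u != 0 ->
  compact_convex K -> locally_ball r K -> maximizer K u p ->
  cball (p - (r / enorm u) *: u) r `<=` K.
Proof.
move=> r0 u0 [cK vK] loc mp; set c := p - _.
have K0 : K !=set0 by exists p; case: mp.
have [q Hq] := choice (fun v => maximizer_exists v cK K0).
pose h v := dot (q v) v.
have hle x v : K x -> dot x v <= h v by case: (Hq v) => _; apply.
have [M M0 KM] : exists2 M : R, 0 <= M & forall x, K x -> enorm x <= M.
  have [a a0 Ka] := compact_cube_subset cK.
  by exists (a *+ m.+2); [rewrite mulrn_wge0|move=> x /Ka; exact: enorm_le_cube].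
have hlip v w : h v <= h w + M * enorm (v - w).
  have [Kq _] := Hq v; rewrite {1}/h.
  have -> : dot (q v) v = dot (q v) w + dot (q v) (v - w) by rewrite !dotE; ring.
  rewrite lerD ?hle//.
  by apply: le_trans (dot_le_enorm _ _) _; rewrite ler_wpM2r ?enorm_ge0// KM.
have main v : (forall s, 0 <= s <= 1 -> u + s *: (v - u) != 0) ->
    dot c v + r * enorm v <= h v.
  move=> seg0; pose w (s : R) := u + s *: (v - u).
  have wB s t : w s - w t = (s - t) *: (v - u).
    by rewrite /w; apply/rowP => i; rewrite !rVE; ring.
  pose phi s := h (w s) - r * enorm (w s) - dot c (w s).
  suff : 0 <= phi 1.
    by rewrite /phi /w scale1r (addrC u) subrK; lra.
  apply: locally_supported_ge0.
  - apply: (@lipschitz_continuous _ ((M + r + enorm c) * enorm (v - u))) => s t.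
    have h1 := hlip (w s) (w t); have h2 := enormDB (w t) (w s).
    have h3 := normr_dot_le c (w s - w t).
    rewrite (enormB (w t)) in h2.
    move: h1 h2 h3; rewrite wB enormZ dotZr; set E := enorm (v - u).
    have -> : (s - t) * dot c (v - u) = dot c (w s) - dot c (w t).
      by rewrite -dotZr -wB !dotE; ring.
    rewrite ler_norml => h1 h2 /andP[h3 _].
    have := ler_wpM2l (ltW r0) h2.
    by rewrite /phi => h4; nra.
  - have [e _] := maximizer_local_support r0 u0 loc mp.
    have hu : h u = dot p u.
      by apply/eqP; rewrite eq_le hle ?andbT; [case: mp => _; apply; case: (Hq u)|case: mp].
    rewrite /phi /w scale0r addr0 hu e -/c; lra.
  - have [_ [d d0 Hd]] := maximizer_local_support r0 u0 loc mp.
    have D0 : 0 < enorm (v - u) + 1 by rewrite ltr_wpDl ?enorm_ge0.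
    exists (d / (enorm (v - u) + 1)); first by rewrite divr_gt0.
    move=> s; rewrite ltr_pdivlMr// => sd.
    have [|x Kx] := Hd (w s).
      rewrite /w addrAC subrr add0r enormZ; apply: le_lt_trans sd.
      by rewrite ler_wpM2l// lerDl.
    by have := hle x (w s) Kx; rewrite /phi -/c; lra.
  - move=> s0 s01; have ws0 := seg0 s0 s01; rewrite -/(w s0) in ws0.
    have [e [d d0 Hd]] := maximizer_local_support r0 ws0 loc (Hq (w s0)).
    set c' := q (w s0) - _ in e Hd.
    have D0 : 0 < enorm (v - u) + 1 by rewrite ltr_wpDl ?enorm_ge0.
    exists (dot (c' - c) (v - u)), (d / (enorm (v - u) + 1)); split; first by rewrite divr_gt0.
    move=> s; rewrite ltr_pdivlMr// => sd.
    have [|x Kx] := Hd (w s).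
      rewrite wB enormZ; apply: le_lt_trans sd.
      by rewrite ler_wpM2l// lerDl.
    have := hle x (w s) Kx; rewrite /phi {2}/h e.
    have -> : dot (c' - c) (v - u) * (s - s0) = dot c' (w s) - dot c' (w s0) -
      dot c (w s) + dot c (w s0).
      by rewrite mulrC -dotZr -wB !dotE; ring.
    lra.
move=> y yc; apply: contrapT => Ky.
have [v Hv] := separation cK vK Ky.
have hv : h v < dot y v by apply: Hv; case: (Hq v).
(* A point of the ball violates no inequality of [main], so no direction separating [y] from [K] can
   be reached from [u] by a segment avoiding [0]. *)
have far v' : h v' < dot y v' -> ~ (forall s, 0 <= s <= 1 -> u + s *: (v' - u) != 0).
  move=> lt /main; rewrite leNgt => /negP; apply; apply: lt_le_trans lt _.
  rewrite -{1}(subrK c y) dotDl addrC lerD2l; apply: le_trans (dot_le_enorm _ _) _.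
  by rewrite ler_wpM2r ?enorm_ge0.
apply: (far v hv) => s /andP[s0 s1]; apply/eqP => sv.
have [i ui] : exists i, u 0 i != 0.
  apply: contrapT => nu; move/eqP: u0; apply; apply/rowP => i; rewrite mxE.
  by apply: contrapT => ui; apply: nu; exists i; apply/eqP.
(* A second coordinate axis, transverse to one where [u] does not vanish: this is where the
   dimension is at least two. *)
pose j := if i == 0 then lift 0 0 else 0 : 'I_m.+2.
have ji : i != j by rewrite /j; case: (eqVneq i 0) => // ->.
pose g := dot y v - h v; have g0 : 0 < g by rewrite subr_gt0.
have D0 : 0 < M + enorm y + 1 by rewrite ltr_wpDl ?addr_ge0 ?enorm_ge0.
(* Moving [v] by [ep] along a unit vector changes the gap by at most [ep * (M + enorm y)], which is
   less than [g]. *)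
pose ep := g / (M + enorm y + 1); have ep0 : 0 < ep by rewrite divr_gt0.
have epE : ep * (M + enorm y + 1) = g by rewrite divfK// gt_eqF.
pose e := delta_mx 0 j : 'rV[R]_m.+2.
have e1 : enorm e = 1 by exact: enorm_delta.
apply: (far (v + ep *: e)).
  have := hlip (v + ep *: e) v; rewrite addrAC subrr add0r enormZ e1 mulr1 gtr0_norm//.
  rewrite dotDr dotZr; have := normr_dot_le y e; rewrite e1 mulr1 ler_norml => /andP[h1 _] h2.
  by have := ler_wpM2l (ltW ep0) h1; move: epE; rewrite /g; nra.
move=> t /andP[t0 t1]; apply/eqP => tv.
have Ci := congr1 (fun x : 'rV[R]_m.+2 => x 0 i) sv.
have Cj := congr1 (fun x : 'rV[R]_m.+2 => x 0 j) sv.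
have Di := congr1 (fun x : 'rV[R]_m.+2 => x 0 i) tv.
have Dj := congr1 (fun x : 'rV[R]_m.+2 => x 0 j) tv.
have ei : e 0 i = 0 by rewrite mxE (negbTE ji) andbF.
have ej : e 0 j = 1 by rewrite mxE !eqxx.
have z0 k : (0 : 'rV[R]_m.+2) 0 k = 0 by rewrite mxE.
rewrite /= !rVE !z0 ?ei ?ej in Ci Cj Di Dj.
(* Coordinate [i] forces both segments to meet [0] at the same parameter; coordinate [j] then gives
   [s * ep = 0]. *)
have st : s = t.
  apply/eqP; rewrite -subr_eq0 -(mulIr_eq0 _ (mulIf ui)); apply/eqP; nra.
have s00 : s != 0.
  by apply: contra_neq ui => e0; move: Ci; rewrite e0; lra.
have : s * ep = 0 by rewrite -st in Dj; lra.
by move/eqP; rewrite mulf_eq0 (negbTE s00) gt_eqF.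
Qed.

End RollingBall.

(** * Inner parallel bodies and quermassintegrals *)

Section InnerBody.
Variable R : realType.

Definition inner_body m (K : set 'rV[R]_m) (r : R) : set 'rV[R]_m :=
  [set c | cball c r `<=` K].

Lemma in_cballD m (c z : 'rV[R]_m) (r : R) : cball c r (c + z) <-> enorm z <= r.
Proof. by rewrite /cball /edist /= addrAC subrr add0r. Qed.

Lemma in_cball0 m (z : 'rV[R]_m) (r : R) : cball 0 r z <-> enorm z <= r.
Proof. by rewrite /cball /edist /= subr0. Qed.

Lemma inner_body_cc m (K : set 'rV[R]_m) (r : R) : 0 <= r ->
  compact_convex K -> compact_convex (inner_body K r).
Proof.
move=> r0 [cK vK]; have sK : inner_body K r `<=` K.
  by move=> c; apply; rewrite /cball /edist /= subrr enorm0.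
split.
  have [a a0 Ka] := compact_cube_subset cK.
  apply: (@cube_compact _ _ _ a); last exact: subset_trans sK Ka.
  have -> : inner_body K r = \bigcap_(z in cball 0 r) [set c | K (c + z)].
    apply/seteqP; split => c H.
      by move=> z /in_cball0 zr; apply: H; apply/in_cballD.
    move=> x xc; rewrite -(subrK c x) addrC; apply: (H (x - c)).
    by apply/in_cball0.
  apply: closed_bigI => z _.
  apply: (@rV_closed_compact_preimage _ _ K _ (fun c : 'rV[R]_m => c + z)) => // x.
  exact: (cvgD cvg_id (cvg_cst z)).
move=> c c' Hc Hc' t t01 x xc.
pose z := x - (t *: c + (1 - t) *: c').
have -> : x = t *: (c + z) + (1 - t) *: (c' + z).
  by apply/rowP => i; rewrite /z !rVE; ring.
by apply: vK => //; [apply: (Hc (c + z))|apply: (Hc' (c' + z))]; apply/in_cballD.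
Qed.

(** By separation, the sum only has to contain a maximizer for each nonzero direction, and
    [rolling_ball] puts the corresponding centre into the inner body. A separating vector [0] is
    excluded because the sum is nonempty. *)
Lemma inner_bodyD m (K : set 'rV[R]_m.+2) (r : R) : 0 < r ->
  compact_convex K -> K !=set0 -> locally_ball r K ->
  K = minkowski (inner_body K r) (cball 0 r).
Proof.
move=> r0 cK K0 loc; have [cQ vQ] : compact_convex (minkowski (inner_body K r) (cball 0 r)).
  by apply: minkowski_cc; [exact: inner_body_cc (ltW r0) cK|exact: cball_cc].
have maxQ u p : u != 0 -> maximizer K u p -> minkowski (inner_body K r) (cball 0 r) p.
  move=> u0 mp; exists (p - (r / enorm u) *: u), ((r / enorm u) *: u).
  have eu : 0 < enorm u by rewrite enorm_gt0.
  split; [exact: rolling_ball|apply/in_cball0|by rewrite subrK].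
  by rewrite enormZ normrM normfV !gtr0_norm// divfK// gt_eqF.
apply/seteqP; split => x; last first.
  by move=> [c [z [Hc /in_cball0 zr ->]]]; apply: (Hc (c + z)); apply/in_cballD.
move=> Kx; apply: contrapT => nQ; have [v Hv] := separation cQ vQ nQ.
have [v0|v0] := eqVneq v 0.
  have [p mp] := maximizer_exists (delta_mx 0 0) (proj1 cK) K0.
  have d0 : delta_mx 0 0 != 0 :> 'rV[R]_m.+2.
    by rewrite -enorm_eq0 enorm_delta oner_eq0.
  by have := Hv _ (maxQ _ _ d0 mp); rewrite v0 -(scale0r 0) !dotZr !mul0r ltxx.
have [p mp] := maximizer_exists v (proj1 cK) K0.
by have := Hv _ (maxQ _ _ v0 mp); rewrite ltNge; case: mp => _ ->.
Qed.

Definition line m (a b : 'rV[R]_m) : set 'rV[R]_m :=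
  [set z | exists t : R, 0 <= t <= 1 /\ z = t *: a + (1 - t) *: b].

Lemma line_cc m (a b : 'rV[R]_m) : compact_convex (line a b).
Proof.
split.
  have -> : line a b = (fun t : R => t *: a + (1 - t) *: b) @` `[0, 1]%classic.
    apply/seteqP; split => z.
      by move=> [t [t01 ->]]; exists t => //=; rewrite in_itv.
    by move=> [t /=]; rewrite in_itv /= => t01 <-; exists t.
  apply: continuous_compact; last exact: segment_compact.
  apply: continuous_subspaceT; apply: continuous_rV => i.
  under eq_fun do rewrite !rVE.
  move=> t; apply: cvgD; apply: cvgM; try exact: cvg_cst; first exact: cvg_id.
  by apply: cvgB; [exact: cvg_cst|exact: cvg_id].
move=> _ _ [s [/andP[s0 s1] ->]] [s' [/andP[s0' s1'] ->]] t /andP[t0 t1].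
exists (t * s + (1 - t) * s'); split; first by apply/andP; split; nra.
by apply/rowP => i; rewrite !rVE; ring.
Qed.

Lemma line_sub m (a b : 'rV[R]_m) (C : set 'rV[R]_m) : convex_set C -> C a -> C b ->
  line a b `<=` C.
Proof. by move=> vC Ca Cb _ [t [t01 ->]]; exact: vC. Qed.

Lemma lineL m (a b : 'rV[R]_m) : line a b a.
Proof. by exists 1; rewrite scale1r subrr scale0r addr0 ler01 lexx. Qed.

Lemma lineR m (a b : 'rV[R]_m) : line a b b.
Proof. by exists 0; rewrite scale0r subr0 scale1r add0r ler01 lexx. Qed.

(** Puts a sausage into the same form, a compact convex set plus a ball, as the decomposition in
    [inner_bodyD]. *)
Lemma conv_hull_balls m (a b : 'rV[R]_m) (r : R) :
  conv_hull (cball a r `|` cball b r) = minkowski (line a b) (cball 0 r).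
Proof.
apply/seteqP; split => x.
  apply; first by apply: minkowski_convex; [exact: (proj2 (line_cc _ _))|exact: cball_convex].
  move=> y [ya|yb].
    exists a, (y - a); split; [exact: lineL|exact/in_cball0|by rewrite addrC subrK].
  exists b, (y - b); split; [exact: lineR|exact/in_cball0|by rewrite addrC subrK].
move=> [_ [z [[t [t01 ->]] /in_cball0 zr ->]]] C vC HC.
have -> : t *: a + (1 - t) *: b + z = t *: (a + z) + (1 - t) *: (b + z).
  by apply/rowP => i; rewrite !rVE; ring.
by apply: vC => //; apply: HC; [left|right]; apply/in_cballD.
Qed.

Lemma diamE m (K : set 'rV[R]_m) p q : K p -> K q ->
  (forall x y, K x -> K y -> edist x y <= edist p q) -> diam K = edist p q.
Proof.
move=> Kp Kq H; rewrite /diam; set D := [set _ | _].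
have Dpq : D (edist p q) by exists p, q.
have ub : ubound D (edist p q) by move=> _ [x [y [Kx Ky ->]]]; exact: H.
apply/eqP; rewrite eq_le; apply/andP; split.
  by apply: ge_sup => //; exists (edist p q).
by apply: ub_le_sup => //; exists (edist p q).
Qed.

Lemma diam_attained m (K : set 'rV[R]_m) : compact K -> K !=set0 ->
  exists p q, [/\ K p, K q & forall x y, K x -> K y -> edist x y <= edist p q].
Proof.
move=> cK [x0 Kx0].
have K0 : (K `*` K) !=set0 by exists (x0, x0).
have cd : continuous (fun z : 'rV[R]_m * 'rV[R]_m => edist z.1 z.2).
  move=> z; apply: (@cvg_comp _ _ _ (fun z : 'rV[R]_m * 'rV[R]_m => z.1 -
    z.2) (@enorm R m) _ (nbhs (z.1 - z.2))).
    exact: (cvgB cvg_fst cvg_snd).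
  exact: enorm_continuous.
have [[p q] /set_mem [/= Kp Kq] H] :=
  compact_EVT_max K0 (compact_setX cK cK) (continuous_subspaceT cd).
exists p, q; split => // x y Kx Ky; apply: (H (x, y)).
by rewrite inE.
Qed.

Lemma diam_sausage m (a b : 'rV[R]_m.+1) (r : R) : 0 < r ->
  diam (minkowski (line a b) (cball 0 r)) = edist a b + 2 * r.
Proof.
(* When the centres coincide any unit vector serves, hence the positive dimension. *)
move=> r0; pose e : 'rV[R]_m.+1 := if a == b then delta_mx 0 0 else (enorm (a - b))^-1 *: (a - b).
have e1 : enorm e = 1.
  rewrite /e; case: ifPn => [_|ab]; first exact: enorm_delta.
  by rewrite enormZ normfV ger0_norm ?enorm_ge0// mulVf// enorm_eq0 subr_eq0.
have abe : a - b = edist a b *: e.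
  rewrite /e /edist; case: eqP => [->|/eqP ab]; first by rewrite subrr enorm0 scale0r.
  by rewrite scalerA divff ?scale1r// enorm_eq0 subr_eq0.
have d0 : 0 <= edist a b by exact: enorm_ge0.
have pq : edist (a + r *: e) (b - r *: e) = edist a b + 2 * r.
  have -> : edist (a + r *: e) (b - r *: e) = enorm ((edist a b + 2 * r) *: e).
    rewrite /edist; congr enorm; rewrite scalerDl -abe.
    by apply/rowP => i; rewrite !rVE; ring.
  by rewrite enormZ e1 mulr1 ger0_norm// addr_ge0// mulr_ge0// ltW.
have er : enorm (r *: e) <= r by rewrite enormZ e1 mulr1 gtr0_norm.
rewrite -pq; apply: diamE.
- by exists a, (r *: e); split; [exact: lineL|exact/in_cball0|].
- by exists b, (- (r *: e)); split; [exact: lineR|apply/in_cball0; rewrite enormN|].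
move=> _ _ [_ [z [[s [/andP[s0 s1] ->]] /in_cball0 zr ->]]] [_ [z' [[s' [/andP[s0' s1'] ->]]
  /in_cball0 zr' ->]]].
rewrite pq /edist.
have -> : s *: a + (1 - s) *: b + z - (s' *: a + (1 - s') *: b + z') = (s - s') *: (a - b) + (z -
  z').
  by apply/rowP => i; rewrite !rVE; ring.
apply: le_trans (enormD _ _) _; rewrite enormZ; apply: lerD.
  by rewrite ler_piMl ?enorm_ge0// ler_norml; apply/andP; split; lra.
by apply: le_trans (enormD _ _) _; rewrite enormN; lra.
Qed.

(** A reflection taking [a - b] to [a' - b'], followed by the translation by [tau], carries one
    segment to the other together with its parallel bodies. *)
Lemma ball_poly_line m (a b a' b' : 'rV[R]_m) : edist a b = edist a' b' ->
  ball_poly (line a b) = ball_poly (line a' b').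
Proof.
rewrite /edist => ab; apply: eq_bigr => j _; congr (_ *: _).
set t : R := j%:R; pose f x := refl ((a - b) - (a' - b')) x.
have fab : f (a - b) = a' - b' by apply: refl_swap.
pose tau := b' - f b.
have fbt : f b + tau = b' by rewrite /tau addrC subrK.
have fat : f a + tau = a'.
  by move: fab; rewrite /f reflB -/(f a) -/(f b) /tau => e; rewrite addrCA e addrC subrK.
have cM c d : compact (minkowski (line c d) (cball (0 : 'rV[R]_m) t)).
  by apply: minkowski_compact; [exact: (proj1 (line_cc _ _))|exact: cball_compact].
have mM c d : measurable (minkowski (line c d) (cball 0 t) : set (borelV R m)).
  exact: borel_compact.
rewrite /rvol; congr fine.
have key s z : f (s *: a + (1 - s) *: b + z) + tau = s *: a' + (1 - s) *: b' + f z.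
  rewrite /f !reflD !reflZ -/(f a) -/(f b) -/(f z) -fat -fbt.
  by apply/rowP => i; rewrite !rVE; ring.
pose B : set (borelV R m) := [set y : 'rV[R]_m | minkowski (line a' b') (cball 0 t) (y + tau)].
have mB : measurable B.
  apply: (@measurable_continuous _ _ (fun y => y + tau)) => // x.
  exact: (cvgD cvg_id (cvg_cst tau)).
rewrite -(vol_shift tau (mM a' b')) -(vol_refl ((a - b) - (a' - b')) mB).
congr vol; apply/seteqP; split => x.
  move=> [_ [z [[s [s01 ->]] /in_cball0 zt ->]]]; rewrite /B /= -/(f _) key.
  exists (s *: a' + (1 - s) *: b'), (f z); split => //; first by exists s.
  by apply/in_cball0; rewrite enorm_refl.
rewrite /B /= -/(f x) => -[_ [z [[s [s01 ->]] /in_cball0 zt e]]].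
exists (s *: a + (1 - s) *: b), (f z); split; first by exists s.
  by apply/in_cball0; rewrite enorm_refl.
have ff w : f (f w) = w by exact: reflK.
have := key s (f z); rewrite ff -e => /addIr /(congr1 f).
by rewrite !ff.
Qed.

Lemma minkowski_cballs m (r t : R) : 0 < r -> 0 <= t ->
  minkowski (cball (0 : 'rV[R]_m) r) (cball 0 t) = cball 0 (r + t).
Proof.
move=> r0 t0; have rt : 0 < r + t by rewrite ltr_wpDr.
apply/seteqP; split => x.
  move=> [y [z [/in_cball0 yr /in_cball0 zt ->]]]; apply/in_cball0.
  by apply: le_trans (enormD _ _) _; exact: lerD.
move=> /in_cball0 xr; exists ((r / (r + t)) *: x), ((t / (r + t)) *: x); split.
- apply/in_cball0; rewrite enormZ ger0_norm ?divr_ge0 ?(ltW r0) ?(ltW rt)//.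
  by rewrite mulrAC ler_pdivrMr// ler_pM2l.
- apply/in_cball0; rewrite enormZ ger0_norm ?divr_ge0 ?(ltW rt)//.
  by rewrite mulrAC ler_pdivrMr// ler_wpM2l.
- by rewrite -scalerDl -mulrDl divff ?scale1r// gt_eqF.
Qed.

Lemma steiner_polyE m (L : set 'rV[R]_m.+1) (r : R) i : 0 < r -> compact_convex L ->
  (i <= m.+1)%N ->
  (steiner_poly (minkowski L (cball 0 r)))`_i = ((ball_poly L)^`N(i)).[r].
Proof.
move=> r0 cL im; have [us Hus] := ball_zonotopes_exist R m.
set K := minkowski L (cball 0 r); set q := ball_poly L.
pose p : {poly R} := \poly_(i < m.+2) (q^`N(i)).[r].
have pE t : 0 <= t -> vol (minkowski K (scale_set t (cball 0 1))) = (p.[t])%:E.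
  move=> t0; rewrite scale_cballE// /K -minkowskiA minkowski_cballs// vol_rvol; last first.
    by apply: minkowski_compact; [exact: (proj1 cL)|exact: cball_compact].
  rewrite (ball_polyE Hus cL) ?addr_ge0 ?(ltW r0)// -/q.
  rewrite (nderiv_taylor_wide (mulrC r t) (size_ball_poly L)).
  by rewrite horner_poly.
have sp : (size p <= m.+2)%N by exact: size_poly.
pose P := [set p : {poly R} | (size p <= m.+2)%N /\
     forall t : R, 0 <= t ->
       vol (minkowski K (scale_set t (cball 0 1))) = (p.[t])%:E].
have Pp : P p by [].
have [ss Hs] : P (steiner_poly K) by exact: (xgetPex 0 (ex_intro _ p Pp)).
(* The selection by [xget] is unambiguous: two admissible polynomials agree at [m + 2] nodes and
   have size at most [m + 2]. *)
have -> : steiner_poly K = p.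
  rewrite (poly_lagrange ss) (poly_lagrange sp); apply: eq_bigr => j _.
  by congr (_ *: _); apply: EFin_inj; rewrite -pE// Hs.
by rewrite coef_poly ltnS im.
Qed.

End InnerBody.

(** * Strict monotonicity *)

Section Strictness.
Variable R : realType.

(** For a unit vector [nu], the part within distance [t] of the apex [0] of the circular cone about
    [nu] whose half-angle has cosine [k]. *)
Definition sector m (nu : 'rV[R]_m) (k t : R) : set 'rV[R]_m :=
  [set w | enorm w <= t /\ k * enorm w <= dot w nu].

Lemma sector_compact m (nu : 'rV[R]_m) (k t : R) : compact (sector nu k t).
Proof.
apply: (@cube_compact _ _ _ t); last first.
  by move=> w [wt _] i; exact: le_trans (coord_le_enorm w i) wt.
have -> : sector nu k t = [set w | enorm w <= t] `&` [set w | k * enorm w - dot w nu <= 0].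
  by apply/seteqP; split => w [h1 h2]; split => //; move: h2 => /=; rewrite subr_le0.
apply: closedI.
  apply: (@closed_comp _ _ (@enorm R m) [set y | y <= t]); last exact: closed_le.
  by move=> x _; exact: enorm_continuous.
apply: (@closed_comp _ _ (fun w => k * enorm w - dot w nu) [set y | y <= 0]); last exact: closed_le.
move=> x _; exact: (cvgB (cvgM (cvg_cst k) (@enorm_continuous R m x)) (@dot_continuous R m nu x)).
Qed.

(** The axis [nu] is normal to a hyperplane separating [x] from [I]. As [I] is bounded, the gap [d]
    along [nu] persists, halved, for all directions of a thin enough cone, uniformly in [z]. *)
Lemma sector_gap m (I : set 'rV[R]_m) (x : 'rV[R]_m) :
  compact_convex I -> I !=set0 -> ~ I x -> exists nu k eta,
    [/\ enorm nu = 1, 0 <= k < 1, 0 < eta &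
      forall z w, I z -> k * enorm w <= dot w nu -> eta * enorm w <= dot (x - z) w].
Proof.
move=> [cI vI] I0 Ix; have [v Hv] := separation cI vI Ix.
have v0 : v != 0.
  apply/eqP => v0; case: I0 => z Iz; have := Hv z Iz.
  by rewrite v0 -(scale0r 0) !dotZr !mul0r ltxx.
have ev : 0 < enorm v by rewrite enorm_gt0.
have [z0 [Iz0 Hz0]] := maximizer_exists v cI I0.
have [nu nuE] : exists nu, nu = (enorm v)^-1 *: v by exists ((enorm v)^-1 *: v).
have nu1 : enorm nu = 1 by rewrite nuE enormZ normfV gtr0_norm// mulVf ?gt_eqF.
pose d := (dot x v - dot z0 v) / enorm v.
have d0 : 0 < d by rewrite divr_gt0// subr_gt0 Hv.
have Hd z : I z -> d <= dot (x - z) nu.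
  move=> Iz; rewrite nuE dotZr /d mulrC ler_pM2l ?invr_gt0// dotDl dotNl lerD2l lerN2.
  exact: Hz0.
have [M M0 HM] : exists2 M : R, 0 <= M & forall z, I z -> enorm (x - z) <= M.
  have [a a0 Ia] := compact_cube_subset cI.
  exists (enorm x + a *+ m); first by rewrite addr_ge0 ?enorm_ge0// mulrn_wge0.
  move=> z /Ia /enorm_le_cube za; apply: le_trans (enormD _ _) _.
  by rewrite enormN lerD2l.
have dM : d <= M.
  apply: le_trans (Hd _ Iz0) _; apply: le_trans (dot_le_enorm _ _) _.
  by rewrite nu1 mulr1 HM.
have Mp : 0 < M by exact: lt_le_trans dM.
(* If [w] deviates from [enorm w *: nu] by at most [e * enorm w], at most [M * e = d / 2] of the gap
   is lost. *)
pose e := d / (2 * M).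
have e0 : 0 < e by rewrite divr_gt0// mulr_gt0.
have eM : M * e = d / 2 by rewrite /e; field; rewrite gt_eqF.
have e1 : e <= 1 by rewrite -(ler_pM2l Mp) eM; lra.
(* The squared deviation is at most [2 * (1 - k) * enorm w ^+ 2], which equals [(e * enorm w) ^+ 2]
   for this [k]. *)
exists nu, (1 - e ^+ 2 / 2), (d / 2); split => //.
- by apply/andP; split; nra.
- by rewrite divr_gt0.
move=> z w Iz kw; have ew := enorm_ge0 w.
have D : enorm (w - enorm w *: nu) <= e * enorm w.
  have ee : 0 <= e * enorm w by rewrite mulr_ge0// ltW.
  rewrite -(@ler_pXn2r _ 2) ?nnegrE ?enorm_ge0// sqr_enorm.
  rewrite [dot (w - _) _]dotDl !dotDr !dotNl !dotNr !dotZl !dotZr -!sqr_enorm (dotC nu w) nu1.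
  nra.
have -> : dot (x - z) w = enorm w * dot (x - z) nu + dot (x - z) (w - enorm w *: nu).
  by rewrite [dot (x - z) (w - _)]dotDr dotNr dotZr; ring.
have h1 := Hd z Iz.
have := normr_dot_le (x - z) (w - enorm w *: nu); rewrite ler_norml => /andP[h2 _].
have h3 : enorm (x - z) * enorm (w - enorm w *: nu) <= M * (e * enorm w).
  by apply: ler_pM => //; rewrite ?enorm_ge0// HM.
rewrite mulrA eM in h3.
have := ler_wpM2l ew h1; nra.
Qed.

Lemma sector_volume m (nu : 'rV[R]_m.+1) (k : R) : enorm nu = 1 -> 0 <= k < 1 ->
  exists2 th : R, 0 < th & forall t, 0 <= t -> (th * t) ^+ m.+1 <= rvol (sector nu k t).
Proof.
move=> nu1 /andP[k0 k1]; pose M : R := m.+1%:R; have M0 : 0 < M by rewrite ltr0n.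
(* The cube of half-side [th * t] about [(t / 2) *: nu] has Euclidean radius at most
   [(1 - k) / 4 * t], small enough to stay in the sector; the full side gives the constant
   [2 * th]. *)
pose th := (1 - k) / 4 / M.
have th0 : 0 < th by rewrite !divr_gt0// subr_gt0.
have thM : th * M = (1 - k) / 4 by rewrite divfK// gt_eqF.
exists (2 * th); first by rewrite mulr_gt0.
move=> t t0; rewrite -lee_fin -mulrA -vol_cube; last by rewrite mulr_ge0// ltW.
rewrite -vol_rvol; last exact: sector_compact.
have mS : measurable (sector nu k t : set (borelV R m.+1)).
  by apply: borel_compact; exact: sector_compact.
rewrite -(vol_shift ((t / 2) *: nu) mS); apply: le_vol.
- by apply: borel_closed; exact: closed_cube.
- apply: (@measurable_continuous _ _ (fun y => y + (t / 2) *: nu)) => // x.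
  exact: (cvgD cvg_id (cvg_cst ((t / 2) *: nu))).
move=> q /enorm_le_cube; rewrite -[(th * t) *+ _]mulr_natr mulrAC thM => Hq /=.
have e1 : enorm (q + (t / 2) *: nu) <= (1 - k) / 4 * t + t / 2.
  apply: le_trans (enormD _ _) _; rewrite enormZ nu1 mulr1 ger0_norm ?divr_ge0//.
  by rewrite lerD2r.
split; first by nra.
have := normr_dot_le q nu; rewrite nu1 mulr1 ler_norml => /andP[h _].
rewrite [dot (q + _) _]dotDl dotZl -(sqr_enorm nu) nu1 expr1n mulr1.
have := ler_wpM2l k0 e1; have : 0 <= (1 - k) ^+ 2 * t by rewrite mulr_ge0// sqr_ge0.
nra.
Qed.

(* The shell [sector t \ sector (t - eta)] translated to [x] lies in [L + tB] but misses
   [I + tB]. *)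
Lemma sector_increment m (I L : set 'rV[R]_m) (x nu : 'rV[R]_m) (k eta t : R) :
  compact_convex I -> compact_convex L -> I `<=` L -> L x -> 0 < eta ->
  (forall z w, I z -> k * enorm w <= dot w nu -> eta * enorm w <= dot (x - z) w) ->
  eta <= t ->
  rvol (sector nu k t) - rvol (sector nu k (t - eta)) <=
    rvol (minkowski L (cball 0 t)) - rvol (minkowski I (cball 0 t)).
Proof.
move=> cI cL IL Lx eta0 H etat; have t0 : 0 < t by exact: lt_le_trans etat.
have cmp C : compact_convex C -> compact (minkowski C (cball 0 t)).
  by move=> [cC _]; apply: minkowski_compact => //; exact: cball_compact.
have [mu muE] := vol_measure R m.
have muX (X : set (borelV R m)) : mu X = vol (X : set 'rV[R]_m) by rewrite muE.
pose A1 : set (borelV R m) := minkowski I (cball 0 t).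
pose S s : set (borelV R m) := sector nu k s.
pose T s : set (borelV R m) := [set y : 'rV[R]_m | S s (y + - x)].
have mS s : measurable (S s) by apply: borel_compact; exact: sector_compact.
have mT s : measurable (T s).
  apply: (@measurable_continuous _ _ (fun y => y + - x)) => // y.
  exact: (cvgD cvg_id (cvg_cst (- x))).
have mA1 : measurable A1 by apply: borel_compact; exact: cmp.
have mB : measurable (minkowski L (cball 0 t) : set (borelV R m)).
  by apply: borel_compact; exact: cmp.
have vT s : mu (T s) = (rvol (sector nu k s))%:E.
  by rewrite muX -vol_rvol ?(vol_shift (- x) (mS s))//; exact: sector_compact.
have vA1 : mu A1 = (rvol (minkowski I (cball 0 t)))%:E.
  by rewrite muX -vol_rvol//; exact: cmp.
have vL : mu (minkowski L (cball 0 t)) = (rvol (minkowski L (cball 0 t)))%:E.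
  by rewrite muX -vol_rvol//; exact: cmp.
have sub : A1 `|` (T t `\` T (t - eta)) `<=` minkowski L (cball 0 t).
  move=> y [|[[yt _] _]]; first exact: minkowskiS.
  by exists x, (y - x); split; [exact: Lx|exact/in_cball0|rewrite addrC subrK].
have dis : A1 `&` (T t `\` T (t - eta)) = set0.
  apply/seteqP; split => // y [[z [b [Iz /in_cball0 bt e]]] [[wt kw] nT]].
  pose w := y - x.
  have wgt : t - eta < enorm w by rewrite ltNge; apply/negP => le; apply: nT; split.
  have w0 : 0 < enorm w by apply: le_lt_trans wgt; rewrite subr_ge0.
  have h := H z w Iz kw.
  (* Then [dot b w] is at least [(eta + enorm w) * enorm w], more than [t * enorm w], which
     contradicts [enorm b <= t]. *)
  have bE : b = (x - z) + w by rewrite /w e; apply/rowP => i; rewrite !rVE; ring.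
  have := dot_le_enorm b w; rewrite {1}bE dotDl -(sqr_enorm w) leNgt => /negP; apply.
  have : enorm b * enorm w <= t * enorm w by rewrite ler_wpM2r// ltW.
  have : t * enorm w < (eta + enorm w) * enorm w by rewrite ltr_pM2r//; lra.
  by nra.
have sT : T (t - eta) `<=` T t.
  by move=> y [h1 h2]; split => //; apply: le_trans h1 _; rewrite gerBl ltW.
have vD : mu (T t `\` T (t - eta)) = (rvol (sector nu k t) - rvol (sector nu k (t - eta)))%:E.
  transitivity (mu (T t) - mu (T t `&` T (t - eta)%R))%E.
    apply: measureD => //.
    exact: (eq_ind_r (fun z => z < +oo)%E (ltry _) (vT t)).
  by rewrite (setIidr sT) EFinB; congr (_ - _)%E; exact: vT.
have vU : mu (A1 `|` (T t `\` T (t - eta))) = (mu A1 + mu (T t `\` T (t - eta)%R))%E.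
  by apply: measureU => //; exact: measurableD.
have : (mu (A1 `|` (T t `\` T (t - eta)%R)) <= mu (minkowski L (cball 0%R t)))%E.
  by apply: le_measure; rewrite ?inE//; apply: measurableU => //; exact: measurableD.
rewrite vU (_ : (_ + _)%E = (rvol (minkowski I (cball 0 t)) +
    (rvol (sector nu k t) - rvol (sector nu k (t - eta))))%:E); last first.
  by rewrite EFinD; congr (_ + _)%E; [exact: vA1|exact: vD].
by rewrite vL lee_fin; lra.
Qed.

Lemma poly_le_pow (d : {poly R}) m (T : R) : (forall i, 0 <= d`_i) ->
  (size d <= m.+1)%N -> 1 <= T -> d.[T] <= (\sum_(i < m.+1) d`_i) * T ^+ m.
Proof.
move=> d0 sd T1; rewrite (horner_coef_wide _ sd) mulr_suml; apply: ler_sum => i _.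
by rewrite ler_wpM2l// ler_weXn2l// -ltnS.
Qed.

Lemma horner_nonneg_mono (d : {poly R}) (s t : R) : (forall i, 0 <= d`_i) ->
  0 <= s -> s <= t -> d.[s] <= d.[t].
Proof.
move=> d0 s0 st; rewrite !horner_coef; apply: ler_sum => i _.
by rewrite ler_wpM2l// lerXn2r// nnegrE// (le_trans s0).
Qed.

(* Summing the increments over [t = eta, 2 eta, ..., N eta] makes the left side of order
   [N ^ (m + 2)], while the right side is at most of order [N ^ (m + 1)]. *)
Lemma telescope_growth (d : {poly R}) m (s : R -> R) (eta th : R) :
  (forall i, 0 <= d`_i) -> (size d <= m.+1)%N -> 0 < eta -> 0 < th ->
  (forall t, eta <= t -> s t - s (t - eta) <= d.[t]) ->
  (forall t, 0 <= t -> (th * t) ^+ m.+2 <= s t) -> False.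
Proof.
move=> d0 sd eta0 th0 inc low.
pose A := \sum_(i < m.+1) d`_i.
have A0 : 0 <= A by apply: sumr_ge0.
have sum N : s (N%:R * eta) - s 0 <= N%:R * d.[N%:R * eta].
  elim: N => [|N IH]; first by rewrite !mul0r subrr.
  have N0 : 0 <= N%:R * eta by rewrite mulr_ge0// ltW.
  have NS : N.+1%:R * eta = N%:R * eta + eta by rewrite -natr1; ring.
  have := inc (N.+1%:R * eta); rewrite NS addrK lerDr => /(_ N0) h.
  have mono : d.[N%:R * eta] <= d.[N%:R * eta + eta].
    by apply: horner_nonneg_mono => //; rewrite lerDl ltW.
  have Nn : 0 <= N%:R :> R by [].
  have := ler_wpM2l Nn mono.
  by rewrite -natr1; nra.
have c0 : 0 < th ^+ m.+2 by rewrite exprn_gt0.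
(* For [T >= B] the leading term exceeds the upper bound and the contribution of [s 0] together,
   with [T ^+ m.+1] to spare. *)
pose B := (A + eta * `|s 0| + 1) / (eta * th ^+ m.+2).
have [N HN] : exists N : nat, Num.max 1 B <= N%:R * eta.
  exists (Num.truncn (Num.max 1 B / eta)).+1; rewrite -ler_pdivrMr// ltW//.
  exact: truncnS_gt.
move: (sum N); set T := N%:R * eta in HN * => HT.
have T1 : 1 <= T by rewrite (le_trans _ HN)// le_max lexx.
have TB : B <= T by rewrite (le_trans _ HN)// le_max lexx orbT.
have T0 : 0 < T by exact: lt_le_trans T1.
have dT := poly_le_pow d0 sd T1; rewrite -/A in dT.
have lowT := low T (ltW T0); rewrite exprMn in lowT.
have TB' : A + eta * `|s 0| + 1 <= T * (eta * th ^+ m.+2).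
  by rewrite -ler_pdivrMr// mulr_gt0.
have N0 : 0 <= N%:R :> R by [].
have h1 : eta * (N%:R * d.[T]) <= A * T ^+ m.+1.
  rewrite mulrA (mulrC eta) -/T; apply: le_trans (ler_wpM2l (ltW T0) dT) _.
  by rewrite exprS mulrCA.
have h2 : eta * (s T - s 0) <= eta * (N%:R * d.[T]) by rewrite ler_pM2l.
have h3 : eta * (th ^+ m.+2 * T ^+ m.+2) <= eta * s T by rewrite ler_pM2l.
have P1 : 1 <= T ^+ m.+1 by rewrite exprn_ege1.
have h4 : (A + eta * `|s 0| + 1) * T ^+ m.+1 <= eta * (th ^+ m.+2 * T ^+ m.+2).
  rewrite [T ^+ m.+2]exprS; apply: le_trans (ler_wpM2r (ltW (lt_le_trans ltr01 P1)) TB') _.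
  by rewrite le_eqVlt; apply/orP; left; apply/eqP; ring.
have h5 : eta * s 0 <= eta * `|s 0| by rewrite ler_pM2l// ler_norm.
have h6 : eta * `|s 0| <= eta * `|s 0| * T ^+ m.+1 by rewrite ler_peMr// mulr_ge0// ltW.
by move: h1 h2 h3 h4; rewrite mulrBr; nra.
Qed.

Lemma top_coef_ge0 (p : {poly R}) m : (size p <= m.+2)%N ->
  (forall t, 0 <= t -> 0 <= p.[t]) -> 0 <= p`_m.+1.
Proof.
move=> sp p0; rewrite leNgt; apply/negP => lt.
pose A := \sum_(i < m.+1) `|p`_i|.
have A0 : 0 <= A by apply: sumr_ge0.
have lt' : 0 < - p`_m.+1 by rewrite oppr_gt0.
(* At this point [A] plus the top coefficient times [T] equals the top coefficient, so the value of
   [p] is negative. *)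
pose T := 1 + A / - p`_m.+1.
have T1 : 1 <= T by rewrite lerDl divr_ge0// ltW.
have TA : T * - p`_m.+1 = - p`_m.+1 + A by rewrite mulrDl mul1r divfK// gt_eqF.
have := p0 T (le_trans ler01 T1).
rewrite (horner_coef_wide _ sp) big_ord_recr /= leNgt => /negP; apply.
have h : \sum_(i < m.+1) p`_i * T ^+ i <= A * T ^+ m.
  rewrite mulr_suml; apply: ler_sum => i _; apply: le_trans (ler_norm _) _.
  rewrite normrM ler_wpM2l// ger0_norm ?exprn_ge0 ?(le_trans ler01)//.
  by rewrite ler_weXn2l// -ltnS.
have Tm : 0 < T ^+ m by rewrite exprn_gt0// (lt_le_trans ltr01).
apply: le_lt_trans (lerD h (lexx _)) _.
have -> : A * T ^+ m + p`_m.+1 * T ^+ m.+1 = (A - T * - p`_m.+1) * T ^+ m.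
  by rewrite exprS; ring.
by rewrite TA opprD addrCA subrr addr0 opprK pmulr_llt0.
Qed.

(** If [rho] bounds the distance from [z] to the points of [L], then [L + tB] lies in
    [I + (rho + t)B]. A shift of the variable does not change the top coefficient. *)
Lemma ball_poly_top_coef m (I L : set 'rV[R]_m.+1) : compact_convex I -> I !=set0 ->
  compact_convex L -> (ball_poly L)`_m.+1 <= (ball_poly I)`_m.+1.
Proof.
move=> cI [z Iz] cL; have [us Hus] := ball_zonotopes_exist R m.
have [a a0 La] := compact_cube_subset (proj1 cL).
pose rho := a *+ m.+1 + enorm z.
have rho0 : 0 <= rho by rewrite addr_ge0 ?enorm_ge0// mulrn_wge0.
pose q := ball_poly I; pose P := \poly_(i < m.+2) (q^`N(i)).[rho].
have -> : q`_m.+1 = P`_m.+1.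
  rewrite coef_poly ltnSn -[LHS](hornerC _ rho); congr (_.[rho]).
  apply/polyP => i; rewrite coef_nderivn coefC; case: eqP => [->|/eqP i0].
    by rewrite addn0 binn mulr1n.
  rewrite nth_default ?mul0rn//; apply: leq_trans (size_ball_poly _) _.
  by case: i i0 => // i _; rewrite addnS ltnS leq_addr.
rewrite -subr_ge0 -coefB; apply: top_coef_ge0.
  rewrite (leq_trans (size_polyD _ _))// geq_max size_poly size_polyN.
  exact: size_ball_poly.
move=> t t0; rewrite hornerD hornerN subr_ge0 horner_poly.
rewrite -(nderiv_taylor_wide (mulrC rho t) (size_ball_poly I)).
rewrite -(ball_polyE Hus cL t0) -(ball_polyE Hus cI (addr_ge0 rho0 t0)).
apply: le_rvol.
- by apply: minkowski_compact; [exact: (proj1 cL)|exact: cball_compact].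
- by apply: minkowski_compact; [exact: (proj1 cI)|exact: cball_compact].
move=> _ [y [b [Ly /in_cball0 bt ->]]]; exists z, (y - z + b); split => //.
  apply/in_cball0; apply: le_trans (enormD _ _) _; apply: lerD => //.
  apply: le_trans (enormD _ _) _; rewrite enormN lerD2r.
  exact: enorm_le_cube (La _ Ly).
by rewrite addrA addrC [z + _]addrC subrK addrC.
Qed.

(** Were the coefficients of degree [m + 1] equal, then, the top ones being equal too, [q - p] would
    have degree at most [m], which [telescope_growth] rules out. *)
Lemma coef_lt_of_growth (p q : {poly R}) m (s : R -> R) (eta th : R) :
  (forall i, p`_i <= q`_i) -> (size p <= m.+3)%N -> (size q <= m.+3)%N ->
  q`_m.+2 <= p`_m.+2 -> 0 < eta -> 0 < th ->
  (forall t, eta <= t -> s t - s (t - eta) <= q.[t] - p.[t]) ->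
  (forall t, 0 <= t -> (th * t) ^+ m.+2 <= s t) -> p`_m.+1 < q`_m.+1.
Proof.
move=> le sp sq top eta0 th0 inc low; rewrite lt_neqAle le andbT; apply/eqP => e.
have d0 i : 0 <= (q - p)`_i by rewrite coefB subr_ge0.
have sd : (size (q - p)%R <= m.+1)%N.
  apply/leq_sizeP => j; rewrite leq_eqVlt => /orP[/eqP <-|]; first by rewrite coefB e subrr.
  rewrite leq_eqVlt => /orP[/eqP <-|mj].
    by apply/eqP; rewrite eq_le d0 andbT coefB subr_le0.
  rewrite nth_default// (leq_trans (size_polyD _ _))// size_polyN geq_max.
  by rewrite !(leq_trans _ mj).
apply: (telescope_growth d0 sd eta0 th0 (s := s)) => // t etat.
by rewrite hornerD hornerN inc.
Qed.

Lemma ball_poly_coef_lt m (I L : set 'rV[R]_m.+2) x : compact_convex I -> I !=set0 ->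
  compact_convex L -> I `<=` L -> L x -> ~ I x ->
  (ball_poly I)`_m.+1 < (ball_poly L)`_m.+1.
Proof.
move=> cI I0 cL IL Lx Ix; have [us Hus] := ball_zonotopes_exist R m.+1.
have [nu [k [eta [nu1 k01 eta0 H]]]] := sector_gap cI I0 Ix.
have [th th0 low] := sector_volume nu1 k01.
have inc t : eta <= t -> rvol (sector nu k t) - rvol (sector nu k (t - eta)) <=
    (ball_poly L).[t] - (ball_poly I).[t].
  move=> etat; have t0 : 0 <= t by exact: le_trans (ltW eta0) etat.
  rewrite -(ball_polyE Hus cL t0) -(ball_polyE Hus cI t0).
  exact: sector_increment H etat.
apply: (coef_lt_of_growth _ (size_ball_poly I) (size_ball_poly L)
  (ball_poly_top_coef cI I0 cL) eta0 th0 inc low) => i.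
exact: ball_poly_coef_le Hus cI cL IL.
Qed.

End Strictness.

(** * Monotonicity of quermassintegrals and the inscribed sausage *)

Section Quermassintegrals.
Variable R : realType.

Lemma nderivn_horner_le (p q : {poly R}) i (r : R) : 0 <= r ->
  (forall j, p`_j <= q`_j) -> (p^`N(i)).[r] <= (q^`N(i)).[r].
Proof.
move=> r0 pq; pose N := maxn (size (p^`N(i))) (size (q^`N(i))).
rewrite (horner_coef_wide _ (leq_maxl _ _ : size (p^`N(i)) <= N)%N).
rewrite (horner_coef_wide _ (leq_maxr _ _ : size (q^`N(i)) <= N)%N).
apply: ler_sum => j _; rewrite !coef_nderivn ler_wpM2r ?exprn_ge0//.
by rewrite lerMn2r pq orbT.
Qed.

(** In the Taylor coefficient of order [i] at [r], the coefficient of degree [n] has weight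
    ['C(n, i) * r ^+ (n - i)], positive since [i <= n] and [r > 0]. *)
Lemma nderivn_horner_lt (p q : {poly R}) i n (r : R) : 0 < r -> (i <= n)%N ->
  (forall j, p`_j <= q`_j) -> p`_n < q`_n -> (p^`N(i)).[r] < (q^`N(i)).[r].
Proof.
move=> r0 ni pq pqn.
pose N := (maxn (n - i).+1 (maxn (size (p^`N(i))) (size (q^`N(i)))))%N.
have sp : (size (p^`N(i)) <= N)%N by rewrite !leq_max leqnn orbT.
have sq : (size (q^`N(i)) <= N)%N by rewrite !leq_max leqnn !orbT.
have sn : (n - i < N)%N by rewrite !leq_max leqnn.
rewrite (horner_coef_wide _ sp) (horner_coef_wide _ sq).
rewrite (bigD1 (Ordinal sn))//= [ltRHS](bigD1 (Ordinal sn))//=.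
apply: ltr_leD.
  rewrite !coef_nderivn subnKC// ltr_pM2r ?exprn_gt0//.
  by rewrite ltrMn2r pqn bin_gt0 ni.
apply: ler_sum => j _; rewrite !coef_nderivn ler_wpM2r ?exprn_ge0 ?(ltW r0)//.
by rewrite lerMn2r pq orbT.
Qed.

Lemma quermassE m (L : set 'rV[R]_m.+1) (r : R) i : 0 < r -> compact_convex L ->
  (i <= m.+1)%N ->
  quermass (minkowski L (cball 0 r)) i = ((ball_poly L)^`N(i)).[r] / 'C(m.+1, i)%:R.
Proof. by move=> r0 cL im; rewrite /quermass steiner_polyE. Qed.

Lemma bin_gt0R (m i : nat) : (i <= m)%N -> 0 < ('C(m, i)%:R : R).
Proof. by move=> im; rewrite ltr0n bin_gt0. Qed.

Lemma quermass_le m (I L : set 'rV[R]_m.+1) (r : R) i : 0 < r -> (i <= m.+1)%N ->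
  compact_convex I -> compact_convex L -> I `<=` L ->
  quermass (minkowski I (cball 0 r)) i <= quermass (minkowski L (cball 0 r)) i.
Proof.
move=> r0 im cI cL IL; rewrite !quermassE// ler_pM2r ?invr_gt0 ?bin_gt0R//.
have [us Hus] := ball_zonotopes_exist R m.
apply: nderivn_horner_le; first exact: ltW.
by move=> j; exact: ball_poly_coef_le Hus cI cL IL.
Qed.

Lemma quermass_lt m (I L : set 'rV[R]_m.+2) (r : R) i x : 0 < r -> (i <= m.+1)%N ->
  compact_convex I -> I !=set0 -> compact_convex L -> I `<=` L -> L x -> ~ I x ->
  quermass (minkowski I (cball 0 r)) i < quermass (minkowski L (cball 0 r)) i.
Proof.
move=> r0 im cI I0 cL IL Lx Ix; have im' := leqW im.
rewrite !quermassE// ltr_pM2r ?invr_gt0 ?bin_gt0R//.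
have [us Hus] := ball_zonotopes_exist R m.+1.
apply: (nderivn_horner_lt r0 im); last exact: ball_poly_coef_lt Lx Ix.
by move=> j; exact: ball_poly_coef_le Hus cI cL IL.
Qed.

Lemma quermass_sausage m (a b a' b' : 'rV[R]_m.+1) (r : R) i : 0 < r -> (i <= m.+1)%N ->
  edist a b = edist a' b' ->
  quermass (minkowski (line a b) (cball 0 r)) i =
  quermass (minkowski (line a' b') (cball 0 r)) i.
Proof.
move=> r0 im e; have cl c d := @line_cc R m.+1 c d.
rewrite (quermassE r0 (cl a b) im) (quermassE r0 (cl a' b') im).
by rewrite (ball_poly_line e); exact: erefl.
Qed.

Lemma inner_line m (K : set 'rV[R]_m.+2) (r : R) : 0 < r ->
  compact_convex K -> K !=set0 -> locally_ball r K -> exists a b,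
    [/\ inner_body K r a, inner_body K r b & diam K = edist a b + 2 * r].
Proof.
move=> r0 cK K0 loc; have [p [q [Kp Kq Hpq]]] := diam_attained (proj1 cK) K0.
(* Since [K] contains a ball of radius [r], the two centres do not pass each other on the diameter
   and their distance is [D - 2 * r], without absolute value. *)
have D2r : 2 * r <= edist p q.
  have [x Kx] := K0; move: Kx; rewrite {1}(inner_bodyD r0 cK K0 loc).
  move=> [c [_ [Hc _ _]]].
  pose e : 'rV[R]_m.+2 := delta_mx 0 0.
  have e1 : enorm e = 1 by exact: enorm_delta.
  have er : enorm (r *: e) = r by rewrite enormZ e1 mulr1 gtr0_norm.
  have K1 : K (c + r *: e) by apply: Hc; apply/in_cballD; rewrite er.
  have K2 : K (c + - (r *: e)) by apply: Hc; apply/in_cballD; rewrite enormN er.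
  apply: le_trans (Hpq _ _ K1 K2); rewrite /edist.
  have -> : c + r *: e - (c - r *: e) = (2 * r) *: e by apply/rowP => i; rewrite !rVE; ring.
  by rewrite enormZ e1 mulr1 ger0_norm// mulr_ge0// ltW.
set D := edist p q in D2r.
have D0 : 0 < D by apply: lt_le_trans D2r; rewrite mulr_gt0.
have pq0 : p - q != 0 by rewrite -enorm_gt0.
have qp0 : q - p != 0 by rewrite -enorm_gt0 enormB.
(* A point of [K] farthest from [u] is extremal in the direction away from [u], by
   Cauchy-Schwarz. *)
have maxp u v : K v -> (forall x, K x -> edist x u <= edist v u) -> maximizer K (v - u) v.
  move=> Kv H; split => // x Kx.
  have := dot_le_enorm (x - u) (v - u); have := H x Kx; rewrite /edist => h1 h2.
  have : enorm (x - u) * enorm (v - u) <= enorm (v - u) * enorm (v - u).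
    by rewrite ler_wpM2r// enorm_ge0.
  move=> /(le_trans h2); rewrite -expr2 sqr_enorm [dot (x - u) _]dotDl [dot (v - u) _]dotDl.
  by rewrite lerD2r.
have mp : maximizer K (p - q) p by apply: maxp => // x Kx; exact: Hpq.
have mq : maximizer K (q - p) q by apply: maxp => // x Kx; rewrite (edistC q p); exact: Hpq.
exists (p - (r / D) *: (p - q)), (q - (r / D) *: (q - p)); split.
- exact: rolling_ball r0 pq0 cK loc mp.
- have := rolling_ball r0 qp0 cK loc mq; rewrite (enormB q p); exact.
rewrite (diamE Kp Kq Hpq) -/D.
have -> : edist (p - (r / D) *: (p - q)) (q - (r / D) *: (q - p)) = D - 2 * r;
  last by rewrite subrK.
rewrite /edist.
have -> : p - (r / D) *: (p - q) - (q - (r / D) *: (q - p)) = (1 - 2 * (r / D)) *: (p - q).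
  by apply/rowP => i; rewrite !rVE; ring.
have -> : 1 - 2 * (r / D) = (D - 2 * r) / D by field; rewrite gt_eqF.
rewrite enormZ ger0_norm; first by rewrite -/(edist p q) -/D divfK// gt_eqF.
by rewrite divr_ge0 ?subr_ge0// ltW.
Qed.

End Quermassintegrals.

Theorem theorem4p1 (R : realType) (n : nat) (lam : R)
    (K S : set 'rV[R]_(n.+1)) :
  (1 <= n)%N -> 0 < lam ->
  convex_body K -> lambda_concave lam K ->
  sausage lam S -> diam K = diam S ->
  forall i : nat, (i <= n)%N ->
    quermass S i <= quermass K i /\
    (quermass K i = quermass S i <-> sausage lam K).
Proof.
case: n K S => [K S n0|m K S _ lam0 [cK vK [x0 Kx0]] [_ loc] [a' [b' ->]]].
  by case: (notF n0).
rewrite conv_hull_balls => dKS i im.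
have r0 : 0 < lam^-1 by rewrite invr_gt0.
set r := lam^-1 in r0 loc dKS *.
have ccK : compact_convex K by [].
have K0 : K !=set0 by exists x0; exact: interior_subset Kx0.
have KE := inner_bodyD r0 ccK K0 loc.
have [a [b [Ka Kb dK]]] := inner_line r0 ccK K0 loc.
have cI := inner_body_cc (ltW r0) ccK; have cl := line_cc a b.
have lI : line a b `<=` inner_body K r := line_sub (proj2 cI) Ka Kb.
have ab : edist a b = edist a' b' by move: dKS; rewrite dK diam_sausage// => /addIr.
have im' : (i <= m.+2)%N := leqW im.
(* The given sausage is exchanged for the congruent one inside [K], so that the inner bodies are
   comparable by inclusion. *)
rewrite -(quermass_sausage r0 im' ab); split; first by rewrite KE; exact: quermass_le.
split; last first.
  move=> [a2 [b2]]; rewrite conv_hull_balls => KS.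
  (* The diameter determines the length of the segment, hence the sausage up to congruence. *)
  rewrite KS; apply: quermass_sausage => //.
  by move: dK; rewrite KS diam_sausage// => /addIr.
move=> e; exists a, b; rewrite conv_hull_balls {1}KE; congr (minkowski _ _).
apply/seteqP; split; last exact: lI.
(* A centre off the segment would make the inequality strict, so equality forces the inner body to
   be the segment. *)
move=> x Ix; apply: contrapT => nx.
have l0 : line a b !=set0 by exists a; exact: lineL.
by have := quermass_lt r0 im cl l0 cI lI Ix nx; rewrite -KE e ltxx.
Qed.
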